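(* There is a fixed constant $c>0$ such that the following holds for every $n\ge1$. Let $L,\sigma>0$ be arbitrary and let $f:\mathbb{R}^n\to\mathbb{R}$ be $L$-smooth. Define $f_\sigma:\mathbb{R}^n\to\mathbb{R}$ by $f_\sigma(\boldsymbol{x}):=\mathbb{E}_{\boldsymbol{u}\sim\operatorname{Unif}(\mathbb{B}^n)}[f(\boldsymbol{x}+\sigma\boldsymbol{u})]$ for all $\boldsymbol{x}\in\mathbb{R}^n$. Then: (i) $f_\sigma$ is twice differentiable. (ii) For all $\boldsymbol{x},\boldsymbol{y}\in\mathbb{R}^n$, $$\nabla f_\sigma(\boldsymbol{x})=\mathbb{E}_{\boldsymbol{u}\sim\operatorname{Unif}(\mathbb{B}^n)}[\nabla f(\boldsymbol{x}+\sigma\boldsymbol{u})]\quad\text{and}\quad\|\nabla f_\sigma(\boldsymbol{x})-\nabla f_\sigma(\boldsymbol{y})\|\le L\|\boldsymbol{x}-\boldsymbol{y}\|.$$ (iii) For all $\boldsymbol{x},\boldsymbol{y}\in\mathbb{R}^n$, $\nabla^2f_\sigma(\boldsymbol{x})$ is symmetric, $$\nabla^2f_\sigma(\boldsymbol{x})=\mathbb{E}_{\boldsymbol{u}\sim\operatorname{Unif}(\mathbb{B}^n)}[\nabla^2f(\boldsymbol{x}+\sigma\boldsymbol{u})]\quad\text{and}\quad\|\nabla^2f_\sigma(\boldsymbol{x})-\nabla^2f_\sigma(\boldsymbol{y})\|\le\frac{cL\sqrt n}{\sigma}\|\boldsymbol{x}-\boldsymbol{y}\|.$$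
   Context: $\|\cdot\|$ is the Euclidean norm for vectors and the spectral norm for matrices. $\mathbb{B}^n$ is the closed Euclidean unit ball of $\mathbb{R}^n$ and $\operatorname{Unif}(\mathbb{B}^n)$ the uniform distribution on it. A function is $L$-smooth if it is differentiable with $L$-Lipschitz gradient; then its Hessian $\nabla^2f$ exists Lebesgue-almost everywhere (Rademacher), so the expectation of $\nabla^2 f(\boldsymbol{x}+\sigma\boldsymbol{u})$ is over almost every $\boldsymbol{u}$. *)

(* Defs.v *)
From HB Require Import structures.
From mathcomp Require Import all_boot all_order all_algebra.
From mathcomp Require Import all_classical all_reals all_analysis.
From mathcomp Require Import measurable_realfun.

Set Implicit Arguments.
Unset Strict Implicit.
Unset Printing Implicit Defensive.
Import Order.TTheory GRing.Theory Num.Theory.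
Import numFieldNormedType.Exports.

Local Open Scope classical_set_scope.
Local Open Scope ring_scope.

(* R^n is 'rV[R]_n. The library norm `|_| on 'rV[R]_n is the maximum norm; it
   is equivalent to the Euclidean norm [enorm], so the library notions of
   topology and differentiability apply unchanged, but every norm occurring in
   an inequality must be [enorm] or [spectral_norm]. *)

Section euclidean.
Context {R : realType} {n : nat}.
Implicit Types (x y : 'rV[R]_n) (f : 'rV[R]_n -> R).

Definition enorm x : R := Num.sqrt (\sum_(i < n) x ord0 i ^+ 2).

(* For a row vector v, v *m A^T is the transpose of the column A v. *)
Definition spectral_norm (A : 'M[R]_n) : R :=
  sup [set enorm (v *m A^T) | v in [set v : 'rV[R]_n | enorm v <= 1]].

Definition gradient f x : 'rV[R]_n := \row_(i < n) 'd f x (delta_mx ord0 i).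

(* The (i, j) entry is the derivative along e_i of the j-th component of the
   gradient. Where the gradient is not differentiable this is a fixed
   default matrix, the same at every such point. *)
Definition hessian f x : 'M[R]_n := 'J (gradient f) x.

Definition smooth (L : R) f : Prop :=
  (forall x, differentiable f x) /\
  (forall x y, enorm (gradient f x - gradient f y) <= L * enorm (x - y)).

Definition twice_differentiable f : Prop :=
  (forall x, differentiable f x) /\ (forall x, differentiable (gradient f) x).

End euclidean.

(* Measurable structure on R^n: the product sigma-algebra, i.e. the Borel
   one. *)

Definition rV_display : measure_display -> measure_display.
Proof. exact. Qed.

Section measurable_rV.
Context {R : realType} (n : nat).

Let coord (i : 'I_n) (x : 'rV[R]_n) : measurableTypeR R := x ord0 i.

Let rV_set0 : g_sigma_preimage coord set0.
Proof. exact: sigma_algebra0. Qed.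

Let rV_setC A : g_sigma_preimage coord A -> g_sigma_preimage coord (~` A).
Proof. exact: sigma_algebraC. Qed.

Let rV_bigcup (F : _^nat) : (forall i, g_sigma_preimage coord (F i)) ->
  g_sigma_preimage coord (\bigcup_i (F i)).
Proof. exact: sigma_algebra_bigcup. Qed.

HB.instance Definition _ := @isMeasurable.Build
  (rV_display default_measure_display)
  'rV[R]_n (g_sigma_preimage coord) rV_set0 rV_setC rV_bigcup.

Lemma measurable_rV_coord (i : 'I_n) :
  measurable_fun [set: 'rV[R]_n] (fun x : 'rV[R]_n => x ord0 i : R).
Proof.
move=> _ Y mY; rewrite setTI; apply: sub_sigma_algebra => /=.
rewrite -bigcup_seq/=; exists i => /=; first by rewrite mem_index_enum.
by exists Y => //; rewrite setTI.
Qed.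

Lemma measurable_fun_rV d (T : measurableType d) (f : T -> 'rV[R]_n) :
  (forall i, measurable_fun [set: T] (fun t => f t ord0 i : R)) ->
  measurable_fun [set: T] f.
Proof.
move=> mf _ A mA; rewrite setTI.
suff : g_sigma_preimage (fun i => coord i \o f) `<=` measurable.
  by apply; rewrite g_sigma_preimage_comp; exists A => //; rewrite setTI.
apply: smallest_sub; first exact: sigma_algebra_measurable.
rewrite -bigcup_seq; apply: bigcup_sub => i _ _ [B mB <-].
exact: mf.
Qed.

End measurable_rV.

Section lebesgue_rV.
Context {R : realType}.

Definition cons_rV n (p : 'rV[R]_n * R) : 'rV[R]_n.+1 :=
  \row_(i < n.+1) if unlift ord0 i is Some j then p.1 ord0 j else p.2.

Lemma measurable_cons_rV n : measurable_fun setT (@cons_rV n).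
Proof.
apply: measurable_fun_rV => i; rewrite /cons_rV.
under eq_fun do rewrite mxE.
case: unliftP => [j _|_] /=; last exact: measurable_snd.
exact: (measurableT_comp (@measurable_rV_coord R n j) measurable_fst).
Qed.

HB.instance Definition _ n :=
  isMeasurableFun.Build _ _ _ _ (@cons_rV n) (@measurable_cons_rV n).

Definition lebesgue_cons n (mu : {measure set 'rV[R]_n -> \bar R}) :
  set 'rV[R]_n.+1 -> \bar R :=
  pushforward (mu \x lebesgue_measure)%E (@cons_rV n).

Section lebesgue_cons_measure.
Variables (n : nat) (mu : {measure set 'rV[R]_n -> \bar R}).

Let lebesgue_cons0 : lebesgue_cons mu set0 = 0%E.
Proof. by rewrite /lebesgue_cons /pushforward preimage_set0 measure0. Qed.

Let lebesgue_cons_ge0 A : (0 <= lebesgue_cons mu A)%E.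
Proof. exact: (measure_ge0 (mu \x lebesgue_measure)%E). Qed.

Let lebesgue_cons_sigma_additive : semi_sigma_additive (lebesgue_cons mu).
Proof.
have mcons A : measurable A -> measurable (@cons_rV n @^-1` A).
  by move=> mA; rewrite -[X in measurable X]setTI; exact: measurable_cons_rV.
move=> F mF tF mUF; rewrite /lebesgue_cons /pushforward preimage_bigcup.
apply: (@measure_semi_sigma_additive _ _ _ (mu \x lebesgue_measure)%E).
- by move=> k; exact: mcons.
- apply/trivIsetP => i j _ _ ij; rewrite -preimage_setI.
  by move/trivIsetP : tF => /(_ _ _ _ _ ij) ->//; rewrite preimage_set0.
- by rewrite -preimage_bigcup; exact: mcons.
Qed.

HB.instance Definition _ := isMeasure.Build _ _ _ (lebesgue_cons mu)
  lebesgue_cons0 lebesgue_cons_ge0 lebesgue_cons_sigma_additive.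

End lebesgue_cons_measure.

Fixpoint lebesgue_rV n : {measure set 'rV[R]_n -> \bar R} :=
  match n with
  | 0 => \d_(0 : 'rV[R]_0)
  | n'.+1 => lebesgue_cons (lebesgue_rV n')
  end.

End lebesgue_rV.

Section unif_ball.
Context {R : realType} (n : nat).

Definition unit_ball : set 'rV[R]_n := [set u | enorm u <= 1].

Lemma measurable_enorm : measurable_fun setT (@enorm R n).
Proof.
apply: measurableT_comp; first exact: (continuous_measurable_fun (@sqrt_continuous R)).
apply: measurable_sum => i; apply: measurable_funX.
exact: measurable_rV_coord.
Qed.

Lemma measurable_unit_ball : measurable unit_ball.
Proof.
have mE := @measurable_enorm; have m1 := @measurable_cst _ _ _ R setT 1.
by have := measurable_fun_le measurableT mE (m1 _ _); rewrite setTI.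
Qed.

(* The second argument of [mnormalize] is only used when the unit ball has
   measure 0 or +oo, which never happens. *)
Definition unif_ball : probability 'rV[R]_n R :=
  mnormalize (mrestr (@lebesgue_rV R n) measurable_unit_ball)
             (\d_(0 : 'rV[R]_n)).

End unif_ball.

Definition expectation_mx d (T : measurableType d) (R : realType)
    (P : probability T R) (p q : nat) (X : T -> 'M[R]_(p, q)) : 'M[R]_(p, q) :=
  \matrix_(i, j) fine ('E_P[fun t => X t i j])%E.

Definition smoothing (R : realType) (n : nat) (sigma : R) (f : 'rV[R]_n -> R)
    (x : 'rV[R]_n) : R :=
  fine ('E_(unif_ball n)[fun u => f (x + sigma *: u)%R])%E.

(* Main.v *)
(** The gradient of the average [f_sigma] is the average of [grad f], directly
    from the quadratic Taylor bound of an [L]-smooth function. Since [grad f] is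
    Lipschitz, it is differentiable almost everywhere (Rademacher); its
    difference quotients are bounded, so dominated convergence makes the average
    of [grad f] differentiable at every point, with derivative the average of
    the Hessian. Symmetry of that derivative is Schwarz's theorem, which only
    needs [grad f_sigma] to be differentiable at the point.

    For the Lipschitz bound, [<w, (H(x) - H(y)) v>] is a limit of differences
    [E h(u + a) - E h(u)] with [h] bounded by [|w| L] and [a = (x - y) / sigma],
    so it is at most twice this bound times the mass of the part of the unit ball
    that leaves the ball after a translation by [a]. That mass is
    [O(sqrt n * |a|)]: a point [u] of the ball can only leave it if
    [|u| + 2 |<a, u>| + 2 |a|^2 |u| > 1]; slicing this thin shell radially, its
    mass is at most [n + 1] times the mean of [2 |<a, u>| + 2 |a|^2 |u|], and
    [E |<a, u>| <= |a| / sqrt n].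

    Rademacher's theorem: on a line, a Lipschitz function is, up to an affine
    change, monotone with slopes in [0, 1]. Its Stieltjes measure is then
    absolutely continuous, so Radon-Nikodym and the differentiation theorem give
    derivatives almost everywhere on each line, and Fubini gives directional
    derivatives almost everywhere. They are almost everywhere additive in the
    direction, and the countably many integer directions approximate all others. *)

From HB Require Import structures.
Require Import Defs.
From mathcomp Require Import all_boot all_order all_algebra.
From mathcomp Require Import all_classical all_reals all_analysis.
From mathcomp Require Import measurable_realfun beta_distribution ring lra zify.

Set Implicit Arguments.
Unset Strict Implicit.
Unset Printing Implicit Defensive.
Import Order.TTheory GRing.Theory Num.Theory.
Import numFieldNormedType.Exports.

Local Open Scope classical_set_scope.
Local Open Scope ring_scope.

(** * Lebesgue measure on row vectors *)

Section boxes.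
Context {R : realType} (n : nat).
Local Notation V := 'rV[R]_n.

Definition box (a b : V) : set V :=
  [set x | forall i, a ord0 i < x ord0 i < b ord0 i].

Definition boxes : set (set V) := [set box p.1 p.2 | p in [set: V * V]].

Lemma measurable_box a b : measurable (box a b).
Proof.
have -> : box a b = \bigcap_(i in [set: 'I_n])
    (fun x : V => x ord0 i) @^-1` `]a ord0 i, b ord0 i[.
  apply/seteqP; split=> x /=; first by move=> h i _ /=; rewrite in_itv/=.
  by move=> h i; have := h i Logic.I; rewrite /= in_itv.
apply: fin_bigcap_measurable => // i _.
rewrite -[X in measurable X]setTI.
by apply: (@measurable_rV_coord R n i measurableT); exact: measurable_itv.
Qed.

Lemma boxI : setI_closed boxes.
Proof.
move=> _ _ [[a b] _ <-] [[c d] _ <-] /=.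
exists (\row_i Num.max (a ord0 i) (c ord0 i),
        \row_i Num.min (b ord0 i) (d ord0 i)) => //=.
apply/seteqP; split=> x /=.
  move=> h; split => i; have := h i; rewrite !mxE gt_max lt_min;
  by move=> /andP[/andP[? ?] /andP[? ?]]; apply/andP.
move=> [h1 h2] i; have /andP[? ?] := h1 i; have /andP[? ?] := h2 i.
by rewrite !mxE gt_max lt_min; apply/andP; split; apply/andP.
Qed.

Lemma box_cover : \bigcup_k box (const_mx (- k%:R)) (const_mx k%:R) = [set: V].
Proof.
rewrite -subTset => x _.
exists (Num.bound (\sum_i `|x ord0 i|)) => //= i; rewrite !mxE -ltr_norml.
apply: le_lt_trans (archi_boundP _); last exact: sumr_ge0.
by rewrite (bigD1 i)//= lerDl sumr_ge0.
Qed.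

(** A half-space [x_i > r] is the countable union of the boxes whose [i]-th side starts at [r] and
    whose other bounds are [- k] and [k]. Hence the boxes generate every coordinate preimage. *)
Lemma measurable_rVE : (measurable : set (set V)) = <<s boxes >>.
Proof.
apply/seteqP; split; last first.
  apply: smallest_sub; first exact: sigma_algebra_measurable.
  by move=> _ [[a b] _ <-]; exact: measurable_box.
apply: smallest_sub; first exact: smallest_sigma_algebra.
rewrite -bigcup_seq; apply: bigcup_sub => i _ _ [B mB <-].
have mc : measurable_fun (setT : set (g_sigma_algebraType boxes))
    (fun x : g_sigma_algebraType boxes => (x : V) ord0 i : R).
  move=> mT; apply: (measurability _ (RGenOInfty.measurableE R)) => //.
  move=> /= _ [_ [r ->] <-]; rewrite setTI.
  have -> : (fun x : g_sigma_algebraType boxes => (x : V) ord0 i) @^-1` `]r, +oo[ =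
     \bigcup_k box (\row_j if j == i then r else - k%:R) (const_mx k%:R).
    apply/seteqP; split=> x /=.
      rewrite in_itv/= andbT => rx.
      have : [set: V] x by [].
      rewrite -box_cover => -[k _ xk]; exists k => // j.
      have /andP[k1 k2] := xk j; rewrite !mxE in k1 k2 *.
      by apply/andP; split => //; case: eqVneq => // ->.
    move=> [k _ /(_ i)]; rewrite !mxE eqxx => /andP[? _].
    by rewrite in_itv/= andbT.
  apply: bigcupT_measurable => k.
  apply: sub_sigma_algebra.
  by exists (\row_j (if j == i then r else - k%:R), const_mx k%:R).
exact: mc.
Qed.

(** Dynkin's uniqueness theorem: the boxes are stable under intersection, generate the
    sigma-algebra, and countably many of finite mass cover the space. *)
Lemma rV_measure_unique (m1 m2 : {measure set V -> \bar R}) :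
  (forall a b, m1 (box a b) = m2 (box a b)) ->
  (forall a b, (m1 (box a b) < +oo)%E) ->
  forall A, measurable A -> m1 A = m2 A.
Proof.
move=> m12 m1oo A mA.
apply: (measure_unique boxes
  (fun k => box (const_mx (- k%:R)) (const_mx k%:R))) => //.
- exact: measurable_rVE.
- exact: boxI.
- by move=> k; exists (const_mx (- k%:R), const_mx k%:R).
- exact: box_cover.
- by move=> _ [[a b] _ <-].
Qed.

End boxes.

(** * Volumes of boxes and uniqueness of Lebesgue measure *)

Section lebesgue_rV_boxes.
Context {R : realType}.
Implicit Types n : nat.

(** Induction on the dimension: [cons_rV] pulls a box back to the product of a lower-dimensional box
    and an interval. *)
Lemma lebesgue_rV_box n (a b : 'rV[R]_n) : (forall i, a ord0 i <= b ord0 i) ->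
  lebesgue_rV n (box a b) = (\prod_i (b ord0 i - a ord0 i))%:E.
Proof.
elim: n a b => [|n IH] a b ab.
  by rewrite big_ord0 /= diracE mem_set// => -[].
rewrite big_ord_recl /= /lebesgue_cons /pushforward.
pose tl (c : 'rV[R]_n.+1) : 'rV[R]_n := \row_j c ord0 (lift ord0 j).
have -> : @cons_rV R n @^-1` box a b =
    box (tl a) (tl b) `*` `]a ord0 ord0, b ord0 ord0[.
  apply/seteqP; split=> -[x t] /=.
    move=> h; split => [j|].
      by have := h (lift ord0 j); rewrite !mxE liftK.
    by have := h ord0; rewrite !mxE unlift_none /= in_itv.
  move=> [h1 h2] i; rewrite !mxE; case: unliftP => [j ->|->] /=.
    by have := h1 j; rewrite !mxE.
  by move: h2; rewrite in_itv.
rewrite product_measure1E//; [|exact: measurable_box].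
rewrite IH; last by move=> i; rewrite !mxE.
rewrite [X in (_ * X)%E](_ : _ = (b ord0 ord0 - a ord0 ord0)%:E); last first.
  rewrite [LHS]lebesgue_measure_itv/= lte_fin.
  case: ltP => // ba; have -> : b ord0 ord0 = a ord0 ord0.
    by apply/eqP; rewrite eq_le ba ab.
  by rewrite subrr.
rewrite -EFinM mulrC; congr (_ * _)%:E.
by apply: eq_bigr => i _; rewrite !mxE.
Qed.

Lemma box_eq0 n (a b : 'rV[R]_n) i : b ord0 i <= a ord0 i -> box a b = set0.
Proof.
move=> ba; rewrite -subset0 => x /(_ i)/andP[/lt_trans h /h].
by rewrite ltNge ba.
Qed.

Lemma lebesgue_rV_box_lty n (a b : 'rV[R]_n) :
  (lebesgue_rV n (box a b) < +oo)%E.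
Proof.
have [/existsP[i ba]|/existsPn h] :=
  boolP [exists i, b ord0 i <= a ord0 i].
  by rewrite (box_eq0 ba) measure0.
by rewrite lebesgue_rV_box ?ltry// => i; move: (h i); rewrite -ltNge => /ltW.
Qed.

(* [lebesgue_rV n] is a [Fixpoint] application; the sigma-finite instance needs a
   constant to be attached to. *)
Definition lam n : set 'rV[R]_n -> \bar R := @lebesgue_rV R n.
Arguments lam n _ : clear implicits.

HB.instance Definition _ n := Measure.copy (lam n) (@lebesgue_rV R n).

Lemma lam_sigma_finite n : sigma_finite setT (lam n).
Proof.
exists (fun k => box (const_mx (- k%:R)) (const_mx k%:R)); first by rewrite box_cover.
by move=> k; split; [exact: measurable_box|exact: lebesgue_rV_box_lty].
Qed.

HB.instance Definition _ n :=
  @Measure_isSigmaFinite.Build _ _ _ (lam n) (@lam_sigma_finite n).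

Lemma lam_unique n (m : {measure set 'rV[R]_n -> \bar R}) :
  (forall a b : 'rV[R]_n, (forall i, a ord0 i < b ord0 i) ->
     m (box a b) = (\prod_i (b ord0 i - a ord0 i))%:E) ->
  forall A, measurable A -> m A = lam n A.
Proof.
move=> mb A mA; apply/esym; apply: rV_measure_unique => //; last exact: lebesgue_rV_box_lty.
move=> a b.
have [/existsP[i ba]|/existsPn h] :=
  boolP [exists i, b ord0 i <= a ord0 i].
  by rewrite (box_eq0 ba) !measure0.
have ab i : a ord0 i < b ord0 i by move: (h i); rewrite -ltNge.
by rewrite mb// [LHS]lebesgue_rV_box// => i; exact: ltW.
Qed.

End lebesgue_rV_boxes.

Arguments lam {R} n _.

(** * Lebesgue measure under affine maps, and Fubini along lines *)

Section lam_invariance.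
Context {R : realType}.
Implicit Types n : nat.

(** The pushforward by [phi], divided by [c], gives boxes their volume and so is Lebesgue measure.
    Translations, dilations, permutations and reflections of coordinates are all handled through
    this criterion. *)
Lemma lam_preimage n (phi : 'rV[R]_n -> 'rV[R]_n) (c : R) :
  measurable_fun setT phi -> 0 < c ->
  (forall a b : 'rV[R]_n, (forall i, a ord0 i < b ord0 i) ->
    lam n (phi @^-1` box a b) = (c * \prod_i (b ord0 i - a ord0 i))%:E) ->
  forall A, measurable A -> lam n (phi @^-1` A) = (c%:E * lam n A)%E.
Proof.
move=> mphi c0 cb A mA.
have ci0 : 0 <= c^-1 by rewrite invr_ge0 ltW.
pose pm0 := mscale (NngNum ci0)
  ((pushforward (lam n) phi) : {measure set 'rV[R]_n -> \bar R})
  : {measure set 'rV[R]_n -> \bar R}.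
pose pm := pm0 mphi.
have -> : lam n A = pm A.
  apply/esym/lam_unique => // a b ab.
  rewrite /= /mscale/= /pushforward cb// -EFinM mulrA mulVf ?mul1r// gt_eqF//.
by rewrite /= /mscale/= /pushforward muleA -EFinM divff ?gt_eqF// mul1e.
Qed.

Lemma measurable_coordwise n (g : 'I_n -> 'rV[R]_n -> R) :
  (forall i, measurable_fun setT (g i)) ->
  measurable_fun setT (fun x : 'rV[R]_n => \row_i g i x).
Proof.
move=> mg; apply: measurable_fun_rV => i.
rewrite (_ : (fun _ => _) = g i); first exact: mg.
by apply/funext => x; rewrite mxE.
Qed.

Lemma measurable_affine n (t : 'rV[R]_n) (c : R) :
  measurable_fun setT (fun x : 'rV[R]_n => t + c *: x).
Proof.
apply: measurable_fun_rV => i; under eq_fun do rewrite !mxE.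
apply: measurable_funD => //; apply: measurable_funM => //.
exact: measurable_rV_coord.
Qed.

Lemma lam_translate n (t : 'rV[R]_n) (A : set 'rV[R]_n) : measurable A ->
  lam n ((fun x => x + t) @^-1` A) = lam n A.
Proof.
move=> mA; rewrite -[RHS]mul1e; apply: lam_preimage => //.
  have := measurable_affine t 1; congr (measurable_fun _ _).
  by apply/funext => x; rewrite scale1r addrC.
move=> a b ab.
have -> : (fun x : 'rV[R]_n => x + t) @^-1` box a b = box (a - t) (b - t).
  by apply/seteqP; split=> x /= h i; have := h i; rewrite !mxE ltrBlDr ltrBrDr.
rewrite [LHS]lebesgue_rV_box => [|i]; last by rewrite !mxE lerD2r ltW.
by rewrite mul1r; congr _%:E; apply: eq_bigr => i _; rewrite !mxE; ring.
Qed.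

Lemma lam_scale n (c : R) (A : set 'rV[R]_n) : 0 < c -> measurable A ->
  lam n ((fun x => c *: x) @^-1` A) = ((c^-1 ^+ n)%:E * lam n A)%E.
Proof.
move=> c0 mA; apply: lam_preimage => //.
- rewrite (_ : (fun _ => _) = (fun x : 'rV[R]_n => 0 + c *: x)).
    exact: measurable_affine.
  by apply/funext => x; rewrite add0r.
- by rewrite exprn_gt0// invr_gt0.
move=> a b ab.
have -> : (fun x : 'rV[R]_n => c *: x) @^-1` box a b = box (c^-1 *: a) (c^-1 *: b).
  apply/seteqP; split=> x /= h i; have := h i; rewrite !mxE;
  by rewrite ltr_pdivrMl// ltr_pdivlMl.
rewrite [LHS]lebesgue_rV_box => [|i]; last by rewrite !mxE ler_pM2l ?invr_gt0// ltW.
congr _%:E; under eq_bigr do rewrite !mxE -mulrBr.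
by rewrite big_split/= prodr_const card_ord.
Qed.

Lemma lam_perm n (s s' : 'I_n -> 'I_n) (A : set 'rV[R]_n) : cancel s s' -> cancel s' s ->
  measurable A ->
  lam n ((fun x => \row_i x ord0 (s i)) @^-1` A) = lam n A.
Proof.
move=> sK s'K mA; rewrite -[RHS]mul1e; apply: lam_preimage => //.
  by apply: measurable_coordwise => i; exact: measurable_rV_coord.
move=> a b ab.
have -> : (fun x : 'rV[R]_n => \row_i x ord0 (s i)) @^-1` box a b =
    box (\row_i a ord0 (s' i)) (\row_i b ord0 (s' i)).
  apply/seteqP; split=> x /= h i.
    by have := h (s' i); rewrite !mxE s'K.
  by have := h (s i); rewrite !mxE sK.
rewrite [LHS]lebesgue_rV_box => [|i]; last by rewrite !mxE ltW.
rewrite mul1r; congr _%:E; rewrite (reindex_inj (can_inj sK)) /=.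
by apply: eq_bigr => i _; rewrite !mxE sK.
Qed.

Lemma lam_flip n (i : 'I_n) (A : set 'rV[R]_n) : measurable A ->
  lam n ((fun x => \row_j (if j == i then - x ord0 j else x ord0 j)) @^-1` A)
  = lam n A.
Proof.
move=> mA; rewrite -[RHS]mul1e; apply: lam_preimage => //.
  apply: measurable_coordwise => j; case: eqP => _; last exact: measurable_rV_coord.
  by apply: measurable_funN; exact: measurable_rV_coord.
move=> a b ab.
have -> : (fun x : 'rV[R]_n => \row_j (if j == i then - x ord0 j else x ord0 j))
      @^-1` box a b =
    box (\row_j if j == i then - b ord0 j else a ord0 j)
        (\row_j if j == i then - a ord0 j else b ord0 j).
  apply/seteqP; split=> x /= h j; have := h j; rewrite !mxE; case: eqP => _//.
    by rewrite ltrNr ltrNl andbC.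
  by rewrite ltrNl ltrNr andbC.
rewrite [LHS]lebesgue_rV_box => [|j]; last first.
  by rewrite !mxE; case: eqP => _; rewrite ?lerN2 ltW.
rewrite mul1r; congr _%:E; apply: eq_bigr => j _; rewrite !mxE.
by case: eqP => _//; rewrite opprK addrC.
Qed.

(** The sigma-algebra is defined from the coordinates, so an open set is exhibited as a countable
    union of cubes with rational centres. *)
Lemma open_measurable_rV n (U : set 'rV[R]_n) : open U -> measurable U.
Proof.
move=> oU.
pose bq (q : {ffun 'I_n -> rat} * nat) : set 'rV[R]_n :=
  box (\row_i (ratr (q.1 i) - q.2.+1%:R^-1)) (\row_i (ratr (q.1 i) + q.2.+1%:R^-1)).
pose F q := if asbool (bq q `<=` U) then bq q else set0.
have -> : U = \bigcup_q F q.
  apply/seteqP; split=> x; last first.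
    by move=> [q _]; rewrite /F; case: ifPn => // /asboolP/[apply].
  move=> Ux; have /nbhs_ballP[e /= e0 eU] : nbhs x U by apply: open_nbhs_nbhs.
  (* The rational centre is within [d] of [x] and the cube has half-side [d], so the cube stays
     within [2 d < e] of [x]. *)
  have e20 : 0 < e / 2 by rewrite divr_gt0.
  have [k _ ke] := near_infty_natSinv_lt (PosNum e20).
  have {}ke : k.+1%:R^-1 < e / 2 by apply: ke => /=.
  set d : R := k.+1%:R^-1 in ke.
  have d0 : 0 < d by rewrite invr_gt0.
  have qP i : exists q : rat, ratr q \in `]x ord0 i - d, x ord0 i + d[%R.
    by apply: rat_in_itvoo; lra.
  have /choice[q qx] := qP.
  pose qq : {ffun 'I_n -> rat} * nat := ([ffun i => q i], k).
  exists qq => //; rewrite /F asboolT.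
    move=> i; rewrite !mxE/= ffunE -/d; have := qx i; rewrite in_itv/= => /andP[? ?].
    by apply/andP; split; lra.
  move=> y yq; apply: eU; split => // i j; rewrite ord1.
  have := yq j; rewrite !mxE/= ffunE -/d; have := qx j; rewrite in_itv/=.
  move=> /andP[? ?] /andP[? ?]; rewrite /ball/= ltr_norml; apply/andP; split; lra.
apply: countable_bigcupT_measurable => // q; rewrite /F; case: ifP => // _.
exact: measurable_box.
Qed.

Lemma continuous_measurable_rV n (f : 'rV[R]_n -> R) :
  continuous f -> measurable_fun setT f.
Proof.
move=> /continuousP cf mT; apply: (measurability _ (RGenOpens.measurableE R)) => //.
move=> _ [_ [a [b ->]] <-]; rewrite setTI; apply: open_measurable_rV.
by apply: cf; exact: interval_open.
Qed.

Lemma measurable_line n (x v : 'rV[R]_n) :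
  measurable_fun setT (fun t : R => x + t *: v).
Proof.
apply: measurable_fun_rV => i; under eq_fun do rewrite !mxE.
by apply: measurable_funD => //; apply: measurable_funM.
Qed.

(** Fubini on the pairs [(x, t)] with [x + t *: v] in [N] and [t] in [[0, 1]]: the slices at fixed
    [x] are null, while those at fixed [t] are translates of [N], so the common value of the two
    iterated integrals is both [0] and [lam n N]. *)
Lemma lam_null_lines n (v : 'rV[R]_n) (N : set 'rV[R]_n) : measurable N ->
  (forall x, lebesgue_measure [set t : R | N (x + t *: v)] = 0%E) ->
  lam n N = 0%E.
Proof.
move=> mN N0.
pose S := [set p : 'rV[R]_n * measurableTypeR R | N (p.1 + p.2 *: v) /\ p.2 \in `[0, 1]%R].
have mS : measurable S.
  apply: measurableI.
    rewrite -[X in measurable X]setTI.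
    apply: (_ : measurable_fun setT (fun p : 'rV[R]_n * measurableTypeR R => p.1 + p.2 *: v)) => //.
    apply: measurable_fun_rV => i; under eq_fun do rewrite !mxE.
    apply: measurable_funD.
      exact: (measurableT_comp (@measurable_rV_coord R n i) measurable_fst).
    by apply: measurable_funM => //; exact: measurable_snd.
  rewrite -[X in measurable X]setTI.
  by apply: (@measurable_snd _ _ 'rV[R]_n (measurableTypeR R) measurableT `[0, 1]%classic);
    exact: measurable_itv.
have := @indic_fubini_tonelli _ _ 'rV[R]_n (measurableTypeR R) R (lam n) lebesgue_measure S mS.
rewrite indic_fubini_tonelli_FE// indic_fubini_tonelli_GE//.
rewrite integral0_eq; last first.
  move=> x _ /=; apply/eqP; rewrite eq_le measure_ge0 andbT.
  rewrite -(N0 x); apply: le_measure; rewrite ?inE.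
  - exact: measurable_xsection.
  - by rewrite -[X in measurable X]setTI; exact: measurable_line.
  - by move=> t; rewrite /xsection/= inE => -[].
move=> /esym; rewrite (_ : (fun y => _) = (cst (lam n N)) \_ `[0, 1]%classic).
  rewrite -integral_mkcond integral_cst; last exact: measurable_itv.
  rewrite [X in (_ * X)%E](_ : _ = 1%E) ?mule1//.
  by rewrite [LHS]lebesgue_measure_itv/= lte01 oppr0 adde0.
apply/funext => t /=; rewrite patchE; case: ifPn; rewrite ?inE => t01.
  rewrite /cst -(lam_translate (t *: v) mN); congr (lam n _).
  by apply/seteqP; split=> x; rewrite /ysection/= inE; [case|].
rewrite (_ : ysection _ _ = set0) ?measure0//.
rewrite -subset0 => x; rewrite /ysection/= inE => -[_ /= h].
by move: t01; rewrite notin_setE/=.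
Qed.

End lam_invariance.

(** * Rademacher's theorem *)

Section lipschitz_derivable.
Context {R : realType}.
Local Notation leb := (@lebesgue_measure R).

Lemma lebesgue_stieltjes_itvoc (H : cumulative R R) (a b : R) : a <= b ->
  lebesgue_stieltjes_measure H `]a, b]%classic = (H b - H a)%:E.
Proof.
move=> ab; rewrite /lebesgue_stieltjes_measure/= /measure_extension/=.
by rewrite measurable_mu_extE/=; [rewrite wlength_itv_bnd|exact: is_ocitv].
Qed.

Lemma lipschitz_continuous (U V : normedModType R) (g : U -> V) (M : R) :
  (forall x y, `|g x - g y| <= M * `|x - y|) -> continuous g.
Proof.
move=> gM x; apply/cvgrPdist_lt => e e0.
have M0 : 0 < `|M| + 1 by rewrite ltr_wpDl.
near=> y.
apply: (le_lt_trans (gM _ _)).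
apply: (@le_lt_trans _ _ ((`|M| + 1) * `|x - y|)).
  by rewrite ler_wpM2r// (le_trans (ler_norm _))// lerDl.
rewrite -ltr_pdivlMl// mulrC; near: y.
by apply/nbhs_normP; exists (e / (`|M| + 1)) => //=; exact: divr_gt0.
Unshelve. all: by end_near. Qed.

(* The Stieltjes measures of [h] and of [x - h x] add up to Lebesgue measure, so
   the former is absolutely continuous; by Radon-Nikodym [h] is then an
   indefinite integral. *)
Lemma ae_derivable_nondecreasing (h : R -> R) :
  {homo h : x y / x <= y} -> {homo (fun x => x - h x) : x y / x <= y} ->
  {ae leb, forall x, derivable h x 1}.
Proof.
move=> nd1 nd2.
have hlip (x y : R) : `|h x - h y| <= 1 * `|x - y|.
  rewrite mul1r; wlog xy : x y / x <= y => [W|].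
    have [/W//|/ltW/W] := leP x y.
    by rewrite distrC (distrC y).
  have := nd1 _ _ xy; have := nd2 _ _ xy => /= h1 h2.
  rewrite ler0_norm ?subr_le0// ler0_norm ?subr_le0//; lra.
have h2lip (x y : R) : `|(x - h x) - (y - h y)| <= 1 * `|x - y|.
  rewrite mul1r; wlog xy : x y / x <= y => [W|].
    have [/W//|/ltW/W] := leP x y.
    by rewrite distrC (distrC y).
  have := nd1 _ _ xy; have := nd2 _ _ xy => /= h1 h2.
  rewrite ler0_norm ?subr_le0// ler0_norm ?subr_le0//; lra.
pose H1 : cumulative R R := HB.pack h (isCumulative.Build R _ R h nd1
  (right_continuousW (lipschitz_continuous hlip))).
pose H2 : cumulative R R := HB.pack (fun x => x - h x)
  (isCumulative.Build R _ R (fun x => x - h x) nd2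
  (right_continuousW (lipschitz_continuous h2lip))).
pose m1 : {measure set (measurableTypeR R) -> \bar R} := lebesgue_stieltjes_measure H1.
pose m2 : {measure set (measurableTypeR R) -> \bar R} := lebesgue_stieltjes_measure H2.
have mE A : measure_add m1 m2 A = (m1 A + m2 A)%E by rewrite measure_addE.
have m12oc (a b : R) : a < b -> leb `]a, b]%classic = measure_add m1 m2 `]a, b]%classic.
  move=> ab; rewrite mE [LHS]lebesgue_stieltjes_itvoc ?ltW//.
  rewrite [X in (X + _)%E]lebesgue_stieltjes_itvoc ?ltW//.
  rewrite [X in (_ + X)%E]lebesgue_stieltjes_itvoc ?ltW//=.
  by rewrite -EFinD; congr _%:E; ring.
have m12 A : measurable A -> leb A = measure_add m1 m2 A.
  apply: lebesgue_measure_unique => _ [[a b] _ <-].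
  have [ab|ba] := leP b a; last exact: m12oc.
  by rewrite set_itv_ge ?measure0// bnd_simp -leNgt.
have m1leb A : measurable A -> (m1 A <= leb A)%E.
  by move=> mA; rewrite m12// mE leeDl.
(* On a bounded interval the Stieltjes measure is finite, which makes its density integrable. *)
suff aeK (K : nat) : {ae leb, forall x, - K%:R < x < K%:R -> derivable h x 1}.
  have : {ae leb, forall x K, - K%:R < x < K%:R -> derivable h x 1}.
    exact: ae_foralln.
  apply: (@filterS _ _ (ae_filter_ringOfSetsType leb)) => x.
  move=> /(_ (Num.bound `|x : R|)); apply.
  by rewrite -ltr_norml archi_boundP.
pose D : set (measurableTypeR R) := `]- K%:R, K%:R]%classic.
have mD : measurable D by exact: measurable_itv.
have NK : - K%:R <= K%:R :> R by rewrite (@le_trans _ _ 0)// oppr_le0.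
have m1D : (m1 D < +oo)%E by rewrite [ltLHS]lebesgue_stieltjes_itvoc// ltry.
pose nu : {finite_measure set (measurableTypeR R) -> \bar R} := mfrestr mD m1D.
have nuleb : nu `<< leb.
  apply/null_content_dominatesP => A mA A0.
  apply/eqP; rewrite eq_le measure_ge0 andbT -A0.
  apply: (@le_trans _ _ (m1 A)); last exact: m1leb.
  by rewrite [leLHS]/= /mfrestr /mrestr le_measure// ?inE//; exact: measurableI.
have [f [f0 ffin intf nuf]] := radon_nikodym_sigma_finite nuleb.
pose phi := fine \o f.
have phiE : EFin \o phi = f by apply/funext => x /=; rewrite fineK.
have intphi (A : set R) : measurable A -> leb.-integrable A (EFin \o phi).
  by move=> mA; rewrite phiE; exact: integrableS intf.
have locphi : locally_integrable setT phi.
  by apply: open_integrable_locally; [exact: openT|exact: intphi].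
have := @FTC1 R phi (BRight (- K%:R)) (fun y => intphi _ (measurable_itv _)) locphi.
apply: (@filterS _ _ (ae_filter_ringOfSetsType leb)) => x /= + /andP[Kx xK].
rewrite lte_fin => /(_ Kx)[+ _].
pose F := fun y : R => \int[leb]_(t in [set` Interval (BRight (- K%:R)) (BRight y)]) phi t.
rewrite -/F => dF.
apply: (@near_eq_derivable _ _ _ (F + cst (h (- K%:R)))); last first.
  by apply: derivableD => //; exact: derivable_cst.
(* Near [x] the function [h] is [h (- K)] plus the integral of the density from [- K], so it
   inherits the derivative given by the differentiation theorem. *)
have : \forall y \near x, y \in `]- K%:R, K%:R[%R.
  by apply: near_in_itvoo; rewrite in_itv/= Kx.
apply: filterS => y; rewrite in_itv/= => /andP[Ky yK].
rewrite /F/= -[RHS](subrK (h (- K%:R))); congr (_ + _).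
rewrite /Rintegral; have -> : (\int[leb]_(t in `](- K%:R)%R, y]) (phi t)%:E)%E
   = nu `]- K%:R, y]%classic.
  by rewrite nuf; [rewrite -phiE|exact: measurable_itv].
rewrite [X in fine X]/= /mfrestr /mrestr setIidl; last first.
  by move=> z; rewrite /D/= !in_itv/= => /andP[zK zy]; rewrite zK/= (le_trans zy)// ltW.
by rewrite [X in fine X]lebesgue_stieltjes_itvoc// ltW.
Qed.

(** The function [h] of the proof has slopes in [[0, 1]], and [g] is recovered from it as
    [2 M h - M x]. *)
Lemma ae_derivable_lipschitz (g : R -> R) (M : R) : 0 < M ->
  (forall x y, `|g x - g y| <= M * `|x - y|) ->
  {ae leb, forall x, derivable g x 1}.
Proof.
move=> M0 gM.
pose h x := (x + M^-1 * g x) / 2.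
have nd (s : R) : `|s| = 1 -> {homo (fun x => (x + s * (M^-1 * g x)) / 2) : x y / x <= y}.
  move=> s1 x y xy; rewrite ler_pM2r ?invr_gt0// -subr_ge0.
  have := gM x y; rewrite (ler0_norm (_ : x - y <= 0)) ?subr_le0// => gxy.
  have : `|s * (M^-1 * (g x - g y))| <= y - x.
    rewrite normrM s1 mul1r normrM gtr0_norm ?invr_gt0// ler_pdivrMl//; lra.
  by rewrite mulrBr mulrBr ler_norml => /andP[? ?]; lra.
have := @ae_derivable_nondecreasing h.
move=> /(_ _ _)/wrap[].
- by move=> x y xy; have := nd 1 (normr1 _) x y xy; rewrite !mul1r.
- move=> x y xy; have := nd (- 1) (normrN1 _) x y xy; rewrite /h !mulN1r; lra.
apply: (@filterS _ _ (ae_filter_ringOfSetsType leb)) => x dh.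
have -> : g = (2 * M) \*: h + ((- M) \*: (@idfun R)).
  by apply/funext => y; rewrite /h !fctE /= /GRing.scale/=; field; rewrite gt_eqF.
by apply: derivableD; apply: derivableZ => //; exact: derivable_id.
Qed.

End lipschitz_derivable.

(** * Measurability of limits, and measures given by a density *)

Section measure_lemmas.
Context d (T : measurableType d) (R : realType).

(** By completeness, convergence is the Cauchy property, which countable unions and intersections of
    measurable sets express. *)
Lemma measurable_cvgn (h : nat -> T -> R) : (forall k, measurable_fun setT (h k)) ->
  measurable [set x | cvgn (h ^~ x)].
Proof.
move=> mh.
have -> : [set x | cvgn (h ^~ x)] = \bigcap_m \bigcup_N \bigcap_i
    [set x | `|h (N + i)%N x - h N x| <= m.+1%:R^-1].
  apply/seteqP; split=> x /=.
    move=> /cvg_ex[l hl] m _.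
    have e0 : 0 < m.+1%:R^-1 / 2 :> R by rewrite divr_gt0.
    move/cvgrPdist_le : hl => /(_ _ e0)[N _ hN].
    exists N => // i _ /=; rewrite [leRHS]splitr -(subrKA l).
    rewrite (le_trans (ler_normD _ _))// lerD//; last exact: (hN N (leqnn N)).
    by rewrite distrC; apply: hN; exact: leq_addr.
  move=> hx; apply: cauchy_cvg; apply: cauchy_exP => e e0.
  have [m _ me] := near_infty_natSinv_lt (PosNum e0).
  have [N _ hN] := hx m Logic.I.
  exists (h N x); exists N => // i /= Ni.
  have := hN (i - N)%N Logic.I; rewrite /= subnKC// => h1.
  rewrite /ball/= distrC (le_lt_trans h1)//; exact: (me m (leqnn m)).
apply: bigcapT_measurable => m; apply: bigcupT_measurable => N.
apply: bigcapT_measurable => i; rewrite -[X in measurable X]setTI.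
have mf : measurable_fun setT (fun x => `|h (N + i)%N x - h N x|).
  by apply: measurableT_comp => //; apply: measurable_funB.
exact: (measurable_fun_le measurableT mf (@measurable_cst _ _ _ _ setT _)).
Qed.

Context (mu : {measure set T -> \bar R}).

(** Multiplied by the indicator of the convergence set, the sequence converges everywhere to this
    function. *)
Lemma measurable_lim_cvgn (h : nat -> T -> R) : (forall k, measurable_fun setT (h k)) ->
  measurable_fun setT (fun x => if asbool (cvgn (h ^~ x)) then limn (h ^~ x) else 0).
Proof.
move=> mh; set C := [set x | cvgn (h ^~ x)].
have mC : measurable C := measurable_cvgn mh.
apply: (@measurable_fun_cvg _ _ _ setT (fun k x => h k x * \1_C x)).
  by move=> k; apply: measurable_funM => //; exact: measurable_indic.
move=> x _; case: ifPn => /asboolP cx.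
  by rewrite indicE mem_set//; under eq_fun do rewrite mulr1.
by rewrite indicE memNset//; under eq_fun do rewrite mulr0; exact: cvg_cst.
Qed.

Section density.
Context (f : T -> \bar R).
Context (mf : measurable_fun setT f) (f0 : forall x, (0 <= f x)%E).

Definition density (A : set T) : \bar R := (\int[mu]_(x in A) f x)%E.

Let density0 : density set0 = 0%E.
Proof. exact: integral_set0. Qed.

Let density_ge0 A : (0 <= density A)%E.
Proof. exact: integral_ge0. Qed.

Let density_sigma_additive : semi_sigma_additive density.
Proof.
move=> F mF tF mUF; rewrite /density ge0_integral_bigcup//; last exact: measurable_funTS.
apply: is_cvg_nneseries => k _ _; exact: density_ge0.
Qed.

HB.instance Definition _ := isMeasure.Build _ _ _ density
  density0 density_ge0 density_sigma_additive.

End density.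
End measure_lemmas.

(** * Difference quotients of a Lipschitz function along a direction *)

Section difference_quotients.
Context {R : realType} (n : nat).
Local Notation V := 'rV[R]_n.
Context (g : V -> R) (M : R).
Context (M0 : 0 < M) (gM : forall x y, `|g x - g y| <= M * `|x - y|).

Definition dq (v : V) (k : nat) (z : V) : R :=
  k.+1%:R * (g (z + k.+1%:R^-1 *: v) - g z).

(* A derivative along the sequence of steps [1 / (k + 1)] only, hence measurable
   in [z] without further argument; it is [0] where the limit does not exist. *)
Definition dirderiv (v z : V) : R :=
  if asbool (cvgn (dq v ^~ z)) then limn (dq v ^~ z) else 0.

Lemma dq_le v k z : `|dq v k z| <= M * `|v|.
Proof.
rewrite /dq normrM gtr0_norm// -ler_pdivlMl// (le_trans (gM _ _))//.
by rewrite addrC addKr normrZ gtr0_norm ?invr_gt0// mulrCA.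
Qed.

Lemma measurable_lipschitz : measurable_fun setT g.
Proof. by apply: continuous_measurable_rV; exact: lipschitz_continuous gM. Qed.

Lemma measurable_translate (t : V) : measurable_fun setT (fun x : V => x + t).
Proof.
rewrite (_ : (fun _ => _) = (fun x : V => t + 1 *: x)); first exact: measurable_affine.
by apply/funext => x; rewrite scale1r addrC.
Qed.

Lemma measurable_dq v k : measurable_fun setT (dq v k).
Proof.
apply: measurable_funM => //; apply: measurable_funB; last exact: measurable_lipschitz.
exact: (measurableT_comp measurable_lipschitz (measurable_translate _)).
Qed.

Lemma measurable_dirderiv v : measurable_fun setT (dirderiv v).
Proof. exact: (measurable_lim_cvgn (measurable_dq v)). Qed.

Lemma dirderiv_le v z : `|dirderiv v z| <= M * `|v|.
Proof.
rewrite /dirderiv; case: ifPn => [/asboolP cz|_]; last first.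
  by rewrite normr0 mulr_ge0// ltW.
rewrite -lim_norm//; apply: limr_le; first exact: is_cvg_norm.
by near=> k; exact: dq_le.
Unshelve. all: by end_near. Qed.

Lemma cvg_dirderiv v z : cvgn (dq v ^~ z) -> dq v ^~ z @ \oo --> dirderiv v z.
Proof. by move=> cz; rewrite /dirderiv asboolT. Qed.

Lemma cvg_harmonic_dnbhs : (fun k => k.+1%:R^-1 : R) @ \oo --> (0 : R)^'.
Proof.
move=> A /nbhs_normP[e /= e0 eA].
have [N _ hN] := near_infty_natSinv_lt (PosNum e0).
exists N => // k Nk; apply: eA; last by rewrite /= gt_eqF// invr_gt0.
by rewrite /= sub0r normrN gtr0_norm ?invr_gt0//; exact: hN.
Qed.

Lemma derivable_cvg_dq (phi : R -> R) (t : R) : derivable phi t 1 ->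
  cvgn (fun k => k.+1%:R * (phi (t + k.+1%:R^-1) - phi t)).
Proof.
move=> /cvg_ex[l hl]; apply/cvg_ex; exists l.
have := @cvg_comp _ _ _ (fun k : nat => k.+1%:R^-1 : R)
  (fun h : R => h^-1 *: ((phi \o shift t) (h *: 1) - phi t)) _ _ (nbhs l)
  cvg_harmonic_dnbhs hl.
apply: cvg_trans.
apply: near_eq_cvg; near=> k; rewrite /= invrK /GRing.scale/= mulr1.
by rewrite (addrC t).
Unshelve. all: by end_near. Qed.

(** The set of divergence is Borel and, by the one-dimensional theorem, meets every line of
    direction [v] in a null set; [lam_null_lines] concludes. *)
Lemma ae_cvg_dq v : {ae lam n, forall z, cvgn (dq v ^~ z)}.
Proof.
pose C := [set z | cvgn (dq v ^~ z)].
have mC : measurable C := measurable_cvgn (measurable_dq v).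
exists (~` C); split => //; first exact: measurableC.
apply: (lam_null_lines (v := v)); first exact: measurableC.
move=> x.
have mT : measurable [set t : measurableTypeR R | (~` C) (x + t *: v)].
  rewrite -[X in measurable X]setTI; apply: (@measurable_line R n x v) => //.
  exact: measurableC.
apply: measure_negligible => //.
(* The summand [1] keeps the Lipschitz constant positive when [v = 0]. *)
have phiM (s t : R) :
    `|g (x + s *: v) - g (x + t *: v)| <= (M * `|v| + 1) * `|s - t|.
  rewrite (le_trans (gM _ _))// opprD addrACA subrr add0r -scalerBl normrZ.
  by rewrite mulrCA mulrC ler_wpM2r// lerDl.
have := ae_derivable_lipschitz _ phiM.
move=> /(_ (ltr_wpDl (mulr_ge0 (ltW M0) (normr_ge0 v)) ltr01)).
apply: negligibleS => t /= + /derivable_cvg_dq; apply: contra_not.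
by under [X in X @ _]eq_fun do rewrite scalerDl addrA.
Qed.

End difference_quotients.

Lemma bounded_cvg_integral d (T : measurableType d) (R : realType)
    (mu : {measure set T -> \bar R}) (A : set T) (u_ : nat -> T -> R) (u : T -> R)
    (B : R) :
  measurable A -> (mu A < +oo)%E ->
  (forall k, measurable_fun setT (u_ k)) -> measurable_fun setT u ->
  (forall k x, `|u_ k x| <= B) -> {ae mu, forall x, u_ ^~ x @ \oo --> u x} ->
  (\int[mu]_(x in A) (u_ k x)%:E)%E @[k --> \oo] --> (\int[mu]_(x in A) (u x)%:E)%E.
Proof.
move=> mA muA mu_ mu0 uB cu.
have [] // := @dominated_convergence _ _ _ mu A mA (fun k x => (u_ k x)%:E)
  (fun x => (u x)%:E) (cst B%:E).
- by move=> k; apply/measurable_EFinP; exact: measurable_funTS.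
- by apply/measurable_EFinP; exact: measurable_funTS.
- apply: filterS cu => x cx _; apply/fine_cvgP; split; first exact: nearW.
  exact: cx.
- apply/integrableP; split; first exact: measurable_cst.
  by rewrite integral_cst// lte_mul_pinfty// ?lee_fin.
- by apply: filterE => x k _; rewrite lee_fin.
Qed.

Lemma integrable_bounded d (T : measurableType d) (R : realType)
    (mu : {measure set T -> \bar R}) (A : set T) (u : T -> R) (B : R) :
  measurable A -> (mu A < +oo)%E -> measurable_fun setT u ->
  (forall x, `|u x| <= B) -> mu.-integrable A (fun x => (u x)%:E).
Proof.
move=> mA muA mu0 uB; apply: measurable_bounded_integrable => //.
  exact: measurable_funTS.
exists B; split; first exact: num_real.
by move=> x Bx y _ /=; exact: le_trans (uB y) (ltW Bx).
Qed.

(** * Integrals over boxes *)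

Section box_integrals.
Context {R : realType} (n : nat).
Local Notation V := 'rV[R]_n.

Lemma integral_lam_translate (f : V -> \bar R) (t : V) : measurable_fun setT f ->
  (lam n).-integrable setT (f \o (fun z => z + t)) ->
  (\int[lam n]_z (f \o (fun z => z + t)%R) z = \int[lam n]_z f z)%E.
Proof.
move=> mf intf.
have mt := measurable_translate t.
pose pm0 := (pushforward (lam n) (fun z => z + t) : {measure set V -> \bar R}).
have := integral_pushforward (measurable_translate t) mf intf measurableT.
rewrite preimage_setT => <-; rewrite -/(pm0 mt).
apply: (eq_measure_integral (lam n) (m1 := pm0 mt)) => A mA _.
by rewrite -[RHS](lam_translate t mA).
Qed.

(** A line in the direction of the [i]-th basis vector meets the hyperplane [z_i = a_i] in one
    point. With [a] a corner of a box, this discards the faces of the box through that corner. *)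
Lemma ae_neq_coord (a : V) : {ae lam n, forall z : V, forall i, z ord0 i != a ord0 i}.
Proof.
apply: filter_forall => i; exists [set z : V | z ord0 i = a ord0 i].
have mN : measurable [set z : V | z ord0 i = a ord0 i].
  rewrite -[X in measurable X]setTI.
  by apply: (@measurable_rV_coord R n i measurableT [set a ord0 i]); exact: measurable_set1.
split => //; last by move=> z /= /negP/negPn/eqP.
apply: (lam_null_lines (v := delta_mx ord0 i)) => // x.
have -> : [set t : R | [set z : V | z ord0 i = a ord0 i] (x + t *: delta_mx ord0 i)] =
    [set a ord0 i - x ord0 i].
  apply/seteqP; split=> t /=; rewrite !mxE !eqxx mulr1; first by move=> <-; ring.
  by move=> ->; ring.
exact: lebesgue_measure_set1.
Qed.

Lemma cvg_harmonicZ (x v : V) i :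
  (x - k.+1%:R^-1 *: v) ord0 i @[k --> \oo] --> x ord0 i.
Proof.
under eq_fun do rewrite !mxE.
rewrite -[X in nbhs X]subr0 -[X in nbhs (_ - X)](mul0r (v ord0 i)).
apply: cvgB; first exact: cvg_cst.
by apply: cvgM; [exact: cvg_harmonic|exact: cvg_cst].
Qed.

(** Away from the hyperplanes carrying the faces, each strict inequality defining the box, or its
    negation, persists under small shifts, so the sequence is eventually constant. *)
Lemma cvg_indic_box (a b v z : V) : (forall i, z ord0 i != a ord0 i) ->
  (forall i, z ord0 i != b ord0 i) ->
  \1_(box a b) (z - k.+1%:R^-1 *: v) @[k --> \oo] --> (\1_(box a b) z : R).
Proof.
move=> za zb; apply: cvg_near_cst.
have : \forall k \near \oo, forall i,
    (a ord0 i < (z - k.+1%:R^-1 *: v) ord0 i < b ord0 i) =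
    (a ord0 i < z ord0 i < b ord0 i).
  apply: filter_forall => i; have hc := @cvg_harmonicZ z v i.
  have h1 : \forall k \near \oo, (a ord0 i < (z - k.+1%:R^-1 *: v) ord0 i) =
      (a ord0 i < z ord0 i).
    have [az|az|az] := ltgtP (a ord0 i) (z ord0 i).
    - by apply: filterS (cvgr_gt _ hc _ az) => k ->.
    - apply: filterS (cvgr_lt _ hc _ az) => k h; apply/negbTE.
      by rewrite -leNgt ltW.
    - by have := za i; rewrite az eqxx.
  have h2 : \forall k \near \oo, ((z - k.+1%:R^-1 *: v) ord0 i < b ord0 i) =
      (z ord0 i < b ord0 i).
    have [az|az|az] := ltgtP (b ord0 i) (z ord0 i).
    - apply: filterS (cvgr_gt _ hc _ az) => k h; apply/negbTE.
      by rewrite -leNgt ltW.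
    - by apply: filterS (cvgr_lt _ hc _ az) => k ->.
    - by have := zb i; rewrite az eqxx.
  by apply: filterS2 h1 h2 => k -> ->.
apply: filterS => k hk; rewrite !indicE; congr (_%:R).
by congr nat_of_bool; apply/idP/idP; rewrite !inE => h i; have := h i; rewrite /= hk.
Qed.

(* [h + B] and [B] are densities of measures that agree on boxes. *)
Lemma integral_boxes_eq0 (h : V -> R) (B : R) : measurable_fun setT h ->
  (forall z, `|h z| <= B) ->
  (forall a b, (\int[lam n]_(z in box a b) (h z)%:E = 0)%E) ->
  {ae lam n, forall z, h z = 0}.
Proof.
move=> mh hB h0.
have hB0 z : (0 <= (h z + B)%:E)%E.
  by rewrite lee_fin; have := hB z; rewrite ler_norml => /andP[? _]; lra.
have mhB : measurable_fun setT (fun z => (h z + B)%:E).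
  by apply/measurable_EFinP; exact: measurable_funD.
have mB : measurable_fun setT (fun z : V => B%:E) by exact: measurable_cst.
have B00 : 0 <= B by exact: le_trans (normr_ge0 (h 0)) (hB 0).
have B0 (z : V) : (0 <= B%:E)%E by rewrite lee_fin.
pose m1 := (density (lam n) (fun z => (h z + B)%:E) : {measure set V -> \bar R}).
pose m2 := (density (lam n) (fun z => B%:E) : {measure set V -> \bar R}).
have intA A : measurable A -> (lam n A < +oo)%E ->
    (m1 mhB hB0 A = \int[lam n]_(z in A) (h z)%:E + m2 mB B0 A)%E.
  move=> mA Aoo; rewrite /= /density; under eq_integral do rewrite EFinD.
  rewrite integralD//; first exact: (integrable_bounded mA Aoo mh hB).
  by apply: (@integrable_bounded _ _ _ _ _ _ B) => // x; rewrite ger0_norm.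
have m12 A : measurable A -> m1 mhB hB0 A = m2 mB B0 A.
  have E a b : m1 mhB hB0 (box a b) = m2 mB B0 (box a b).
    rewrite intA ?h0 ?add0e//; [exact: measurable_box|exact: lebesgue_rV_box_lty].
  apply: rV_measure_unique => // a b; rewrite E /= /density integral_cst//.
    by rewrite lte_mul_pinfty//; exact: lebesgue_rV_box_lty.
  exact: measurable_box.
have aeK (K : nat) : {ae lam n, forall z,
    box (const_mx (- K%:R)) (const_mx K%:R) z -> h z = 0}.
  pose Q : set V := box (const_mx (- K%:R)) (const_mx K%:R).
  have mQ : measurable Q by exact: measurable_box.
  have Qoo : (lam n Q < +oo)%E by exact: lebesgue_rV_box_lty.
  have := @integral_ae_eq _ _ _ (lam n) Q mQ (cst 0%E) (fun z => (h z)%:E)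
    (integrable_bounded mQ Qoo mh hB) (measurable_cst _).
  move=> /(_ _)/wrap[].
    move=> E EQ mE; rewrite integral0.
    have Eoo : (lam n E < +oo)%E by rewrite (le_lt_trans _ Qoo)// le_measure// inE.
    have := intA _ mE Eoo; rewrite m12// => /esym.
    (* Finiteness allows the mass of [E] under [m2] to be cancelled, which leaves a zero integral of
       [h] over [E]. *)
    have m2fin : m2 mB B0 E \is a fin_num.
      by rewrite /= /density integral_cst// fin_numM// ge0_fin_numE.
    by move/(congr1 (fun x => x - m2 mB B0 E)%E); rewrite addeK// subee.
  by apply: filterS => z hz Qz; have [] := hz Qz.
have := ae_foralln aeK; apply: filterS => z hz.
have : [set: V] z by []; rewrite -box_cover => -[k _]; exact: hz.
Qed.

End box_integrals.

(** * Almost everywhere linearity of directional derivatives *)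

Section rademacher_linear.
Context {R : realType} (n : nat).
Local Notation V := 'rV[R]_n.
Context (g : V -> R) (M : R).
Context (M0 : 0 < M) (gM : forall x y, `|g x - g y| <= M * `|x - y|).
Local Notation D := (dirderiv g).

Lemma cvg_integral_dq v (a b : V) :
  (\int[lam n]_(z in box a b) (dq g v k z)%:E)%E @[k --> \oo] -->
  (\int[lam n]_(z in box a b) (D v z)%:E)%E.
Proof.
apply: (@bounded_cvg_integral _ _ _ _ _ _ _ (M * `|v|)).
- exact: measurable_box.
- exact: lebesgue_rV_box_lty.
- by move=> k; exact: measurable_dq.
- exact: measurable_dirderiv.
- by move=> k x; exact: dq_le.
- by apply: filterS (ae_cvg_dq M0 gM v) => z; exact: cvg_dirderiv.
Qed.

Lemma mx_entry_le (x : V) i : `|x ord0 i| <= `|x|.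
Proof.
rewrite [leRHS]/Num.norm/= mx_normrE.
exact: (le_bigmax _ (fun ij : 'I_1 * 'I_n => `|x ij.1 ij.2|) (ord0, i)).
Qed.

(** A change of variables moves the shift from the quotient to the indicator of the box. The shifted
    indicators converge almost everywhere, and dominated convergence applies. *)
Lemma cvg_integral_dq_translate v w (a b : V) :
  (\int[lam n]_(z in box a b) (dq g w k (z + k.+1%:R^-1 *: v)%R)%:E)%E
    @[k --> \oo] --> (\int[lam n]_(z in box a b) (D w z)%:E)%E.
Proof.
pose U := box a b; have mU : measurable U by exact: measurable_box.
(* All shifts have length at most that of [v], so this one box of finite measure contains every
   shifted copy of [U]. *)
pose U' := box (a - const_mx `|v|) (b + const_mx `|v|).
have mU' : measurable U' by exact: measurable_box.
have U'oo : (lam n U' < +oo)%E by exact: lebesgue_rV_box_lty.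
pose c k (z : V) : R := \1_U (z - k.+1%:R^-1 *: v).
have mc k : measurable_fun setT (c k).
  apply: (measurableT_comp (f := \1_U : V -> R)); first exact: measurable_indic.
  exact: measurable_translate.
have cU' k z : c k z != 0 -> U' z.
  rewrite /c indicE; case: (boolP (_ \in _)); last by rewrite eqxx.
  rewrite inE => h _ i; have := h i; rewrite !mxE.
  have k1 : k.+1%:R^-1 <= 1 :> R by rewrite invf_le1// ler1n.
  have : `|k.+1%:R^-1 * v ord0 i| <= `|v|.
    rewrite normrM gtr0_norm ?invr_gt0// -[leRHS]mul1r ler_pM//.
    exact: mx_entry_le.
  move: (_ * v ord0 i) `|v| => p N; rewrite ler_norml => /andP[? ?] /andP[? ?].
  by apply/andP; split; lra.
have UU' z : U z -> U' z.
  move=> h i; have := h i; rewrite !mxE; have := normr_ge0 v => ? /andP[? ?].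
  by apply/andP; split; lra.
have -> : (fun k => \int[lam n]_(z in U) (dq g w k (z + k.+1%:R^-1 *: v)%R)%:E)%E =
    (fun k => \int[lam n]_(z in U') (c k z * dq g w k z)%:E)%E.
  apply/funext => k; rewrite integral_mkcond [RHS]integral_mkcond.
  pose F := fun z : V => (c k z * dq g w k z)%:E.
  have FE : F \_ U' = F.
    apply/funext => z; rewrite patchE; case: ifPn => //; rewrite notin_setE => nU'.
    have [c0|/cU'//] := eqVneq (c k z) 0.
    by rewrite /F c0 mul0r.
  have mF : measurable_fun setT F.
    apply/measurable_EFinP; apply: measurable_funM => //; exact: measurable_dq gM w k.
  rewrite [in RHS]FE -(@integral_lam_translate _ _ F (k.+1%:R^-1 *: v))//.
    apply: eq_integral => z _; rewrite patchE /F/= /c addrK indicE.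
    by case: ifPn => zU; rewrite ?mul1r ?mul0r.
  have iUU : (lam n).-integrable U (F \o (fun z => z + k.+1%:R^-1 *: v)).
    apply: (@integrable_bounded _ _ _ _ _ (fun z : V =>
      c k (z + k.+1%:R^-1 *: v) * dq g w k (z + k.+1%:R^-1 *: v)) (M * `|w|)) => //.
    - exact: lebesgue_rV_box_lty.
    - exact: (measurableT_comp (measurable_funM (mc k) (measurable_dq gM w k))
        (measurable_translate _)).
    - move=> z; rewrite normrM -[leRHS]mul1r ler_pM//; last exact: dq_le.
      by rewrite /c indicE; case: (_ \in _); rewrite ?normr1 ?normr0.
  move/(integrable_mkcond _ mU) : iUU; apply: eq_integrable => // z _.
  rewrite patchE; case: ifPn => // zU.
  by rewrite /F/= /c addrK indicE (negbTE zU) mul0r.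
have -> : (\int[lam n]_(z in U) (D w z)%:E = \int[lam n]_(z in U') (\1_U z * D w z)%:E)%E.
  rewrite integral_mkcond [RHS]integral_mkcond; apply: eq_integral => z _.
  rewrite !patchE indicE; case: (boolP (z \in U)) => zU.
    by rewrite mem_set ?mul1r//; apply: UU'; rewrite inE in zU.
  by rewrite mul0r; case: ifP.
apply: (@bounded_cvg_integral _ _ _ _ _ _ _ (M * `|w|)) => //.
- by move=> k; apply: measurable_funM => //; exact: measurable_dq.
- apply: measurable_funM; first exact: measurable_indic.
  exact: measurable_dirderiv.
- move=> k z; rewrite normrM -[leRHS]mul1r ler_pM//; last exact: dq_le.
  by rewrite /c indicE; case: (_ \in _); rewrite ?normr1 ?normr0.
- apply: filterS3 (ae_neq_coord a) (ae_neq_coord b) (ae_cvg_dq M0 gM w) => z za zb zw.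
  apply: cvgM; first exact: cvg_indic_box.
  exact: cvg_dirderiv.
Qed.

(* [dq (v + w) k z = dq v k z + dq w k (z + v / (k + 1))]: the shift disappears
   when integrating over a box and passing to the limit. *)
Lemma ae_dirderivD v w : {ae lam n, forall z, D (v + w) z = D v z + D w z}.
Proof.
pose h z := D (v + w) z - (D v z + D w z).
have mh : measurable_fun setT h.
  apply: measurable_funB; first exact: measurable_dirderiv gM _.
  by apply: measurable_funD; exact: measurable_dirderiv gM _.
have intD u (a b : V) : (lam n).-integrable (box a b) (fun z => (D u z)%:E).
  apply: (@integrable_bounded _ _ _ _ _ _ (M * `|u|)).
  - exact: measurable_box.
  - exact: lebesgue_rV_box_lty.
  - exact: measurable_dirderiv gM u.
  - by move=> z; exact: dirderiv_le.
have hB z : `|h z| <= M * `|v + w| + (M * `|v| + M * `|w|).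
  rewrite (le_trans (ler_normB _ _))// lerD ?dirderiv_le//.
  by rewrite (le_trans (ler_normD _ _))// lerD ?dirderiv_le.
have h0 (a b : V) : (\int[lam n]_(z in box a b) (h z)%:E = 0)%E.
  have mU := measurable_box a b.
  have Uoo := lebesgue_rV_box_lty a b.
  have intdq u k : (lam n).-integrable (box a b) (fun z => (dq g u k z)%:E).
    apply: (@integrable_bounded _ _ _ _ _ _ (M * `|u|)) => //.
    - exact: measurable_dq gM u k.
    - by move=> z; exact: dq_le.
  have intdqt u k t : (lam n).-integrable (box a b) (fun z => (dq g u k (z + t))%:E).
    apply: (@integrable_bounded _ _ _ _ _ (fun z : V => dq g u k (z + t)) (M * `|u|)) => //.
    - exact: (measurableT_comp (measurable_dq gM u k) (measurable_translate _)).
    - by move=> z; exact: dq_le.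
  have S1 := @cvg_integral_dq (v + w) a b.
  have S2 := @cvg_integral_dq v a b.
  have S3 := @cvg_integral_dq_translate v w a b.
  have finD u : (\int[lam n]_(z in box a b) (D u z)%:E)%E \is a fin_num.
    exact: integrable_fin_num.
  have S23 := cvgeD (fin_num_adde_defr _ (finD v)) S2 S3.
  have E k : (\int[lam n]_(z in box a b) (dq g (v + w) k z)%:E =
     \int[lam n]_(z in box a b) (dq g v k z)%:E +
     \int[lam n]_(z in box a b) (dq g w k (z + k.+1%:R^-1 *: v)%R)%:E)%E.
    rewrite -integralD//; apply: eq_integral => z _; rewrite -EFinD; congr _%:E.
    by rewrite /dq scalerDr addrA; ring.
  have := cvg_lim (@ereal_hausdorff R) S1.
  under [X in lim (X @ _)]eq_fun do rewrite E.
  rewrite (cvg_lim (@ereal_hausdorff R) (S23 _)) => E2.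
  rewrite /h; under eq_integral do rewrite EFinB EFinD.
  rewrite integralB//; last exact: integrableD.
  by rewrite integralD// -E2 subee// fin_numD !finD.
by apply: filterS (integral_boxes_eq0 mh hB h0) => z /subr0_eq.
Qed.

Lemma dirderiv0 z : D 0 z = 0.
Proof.
rewrite /dirderiv; case: ifPn => // _.
rewrite (_ : dq g 0 ^~ z = cst 0) ?lim_cst//.
by apply/funext => k; rewrite /dq scaler0 addr0 subrr mulr0.
Qed.

(** Natural multiples follow from additivity by induction, and negative ones from additivity applied
    to a vector and its opposite. *)
Lemma ae_dirderivMz v (c : int) :
  {ae lam n, forall z, D (c%:~R *: v) z = c%:~R * D v z}.
Proof.
have nat p u : {ae lam n, forall z, D (p%:R *: u) z = p%:R * D u z}.
  elim: p => [|p IH].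
    by apply: filterE => z; rewrite scale0r mul0r dirderiv0.
  apply: filterS2 IH (ae_dirderivD (p%:R *: u) u) => z h1 h2.
  by rewrite -natr1 scalerDl scale1r h2 h1 mulrDl mul1r.
case: c => p; first exact: nat.
have := ae_dirderivD (p.+1%:R *: v) (- (p.+1%:R *: v)).
apply: filterS2 (nat p.+1 v) => z h1.
rewrite subrr dirderiv0 h1 => /esym/eqP; rewrite addrC addr_eq0 => /eqP e.
by rewrite NegzE !mulrNz scaleNr e mulNr.
Qed.

Lemma ae_dirderiv_linear (c : 'I_n -> int) : {ae lam n, forall z,
  D (\row_i (c i)%:~R) z = \sum_i (c i)%:~R * D (delta_mx ord0 i) z}.
Proof.
have -> : (\row_i (c i)%:~R : V) = \sum_i (c i)%:~R *: delta_mx ord0 i.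
  by rewrite [LHS]row_sum_delta; apply: eq_bigr => i _; rewrite mxE.
elim: (index_enum _) => [|i s IH].
  by apply: filterE => z; rewrite !big_nil dirderiv0.
apply: filterS3 IH (ae_dirderivMz (delta_mx ord0 i) (c i))
  (ae_dirderivD ((c i)%:~R *: delta_mx ord0 i)
    (\sum_(j <- s) (c j)%:~R *: delta_mx ord0 j)) => z h1 h2 h3.
by rewrite !big_cons h3 h2 h1.
Qed.

End rademacher_linear.

(** * From directional derivatives to the total differential *)

Section frechet.
Context {R : realType}.

Lemma rV_norm_le n (x : 'rV[R]_n) (c : R) : 0 <= c ->
  (forall i, `|x ord0 i| <= c) -> `|x| <= c.
Proof.
move=> c0 xc; rewrite [leLHS]/Num.norm/= mx_normrE.
by apply: bigmax_le => // -[i j] _; rewrite ord1.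
Qed.

(** The epsilon form of a first-order expansion; uniqueness of the differential identifies it with
    [A]. *)
Lemma frechet_diff (V W : normedModType R) (f : V -> W) x (A : {linear V -> W}) :
  continuous A ->
  (forall e, 0 < e -> \forall h \near (0 : V), `|f (x + h) - f x - A h| <= e * `|h|) ->
  differentiable f x /\ 'd f x = A :> (V -> W).
Proof.
move=> cA fA.
have E : f \o shift x = cst (f x) + A +o_ 0 id.
  apply/eqaddoP => e e0; apply: filterS (fA e e0) => h.
  by rewrite !fctE /= opprD addrA (addrC h).
have dE := diff_unique cA E.
by split=> //; apply/diff_locallyP; rewrite dE.
Qed.

Lemma diff_frechet (V W : normedModType R) (f : V -> W) x : differentiable f x ->
  forall e, 0 < e -> \forall h \near (0 : V), `|f (x + h) - f x - 'd f x h| <= e * `|h|.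
Proof.
move=> /diff_locallyP[_ /eqaddoP] E e e0; apply: filterS (E e e0) => h.
by rewrite !fctE /= opprD addrA (addrC h).
Qed.

(** Codes the integers between [- N] and [N] by ordinals below [2 N + 1], so that bounded integer
    directions form a finite type. *)
Lemma inord_shiftK (N : nat) (m : int) : - N%:Z <= m <= N%:Z ->
  (inord (absz (m + N%:Z)) : 'I_(N + N).+1)%:Z - N%:Z = m.
Proof. by move=> mN; rewrite inordK; lia. Qed.

Lemma leq_double_succ k : (k.+2 <= 2 * k.+1)%N.
Proof. lia. Qed.

(* An increment [h] is compared with [m / (k + 1)] for an integer vector [m] whose
   entries are bounded by some [N] depending on [e] only and a [k] of order
   [N / `|h|]; only finitely many directions [m] occur. *)
Lemma lipschitz_frechet n (g : 'rV[R]_n -> R) (M : R) z :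
  0 < M -> (forall x y, `|g x - g y| <= M * `|x - y|) ->
  (forall c : 'I_n -> int, cvgn (dq g (\row_i (c i)%:~R) ^~ z)) ->
  (forall c : 'I_n -> int, dirderiv g (\row_i (c i)%:~R) z =
     \sum_i (c i)%:~R * dirderiv g (delta_mx ord0 i) z) ->
  forall e, 0 < e -> \forall h \near (0 : 'rV[R]_n),
    `|g (z + h) - g z - \sum_i h ord0 i * dirderiv g (delta_mx ord0 i) z| <= e * `|h|.
Proof.
move=> M0 gM cz lz e e0.
set d := fun i => dirderiv g (delta_mx ord0 i) z.
pose M' := \sum_i `|d i|.
have M'0 : 0 <= M' by exact: sumr_ge0.
have dM' (x : 'rV[R]_n) (c : R) : (forall i, `|x ord0 i| <= c) ->
    `|\sum_i x ord0 i * d i| <= c * M'.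
  move=> xc; rewrite (le_trans (ler_norm_sum _ _ _))// /M' mulr_sumr ler_sum// => i _.
  by rewrite normrM ler_wpM2r.
pose C := M + M'.
have C0 : 0 < C by rewrite ltr_wpDr.
(* The total error below is at most [(C + 1) / (k + 1)] while [N < 2 (k + 1) |h|], so this [N]
   brings the error under [e |h|]. *)
have [N N_gt0 NC] : exists2 N : nat, (0 < N)%N & 2 * (C + 1) <= e * N%:R.
  exists (Num.bound (2 * (C + 1) / e)).+1 => //.
  rewrite -ler_pdivrMl// mulrC (le_trans (ltW (archi_boundP _)))//.
    by rewrite divr_ge0// ltW// mulr_gt0// addr_gt0.
  by rewrite ler_nat.
have N0 : 0 < N%:R :> R by rewrite ltr0n.
pose cof (f : {ffun 'I_n -> 'I_(N + N).+1}) (i : 'I_n) : int := (f i : nat)%:Z - N%:Z.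
have : \forall k \near \oo, forall f,
    `|dirderiv g (\row_i (cof f i)%:~R) z - dq g (\row_i (cof f i)%:~R) k z| <= 1.
  by apply: filter_forall => f; exact: (cvgrPdist_le _ _).1 (cvg_dirderiv (cz (cof f))) _ ltr01.
move=> [K _ HK].
have K0 : 0 < K.+2%:R :> R by [].
(* This radius makes [t = N / |h|] exceed [K + 2], so the integer part of [t] is [k + 1] with
   [k > K]. *)
apply/nbhs_normP; exists (N%:R / K.+2%:R) => /=; first by rewrite divr_gt0.
move=> h /=; rewrite sub0r normrN => hd.
have [->|h0] := eqVneq h 0.
  rewrite addr0 subrr normr0 mulr0 big1 ?subrr ?normr0// => i _.
  by rewrite mxE mul0r.
have {}h0 : 0 < `|h| by rewrite normr_gt0.
pose t := N%:R / `|h|.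
have t0 : 0 <= t by rewrite divr_ge0// ltW.
have tK : K.+2%:R < t by rewrite ltr_pdivlMr// mulrC -ltr_pdivlMr.
have /andP[kt tk] := truncn_itv t0.
set kk := Num.truncn t in kt tk.
have Kk : (K.+2 <= kk)%N by rewrite -ltnS -(ltr_nat R) (lt_trans tK).
have [k kkE] : exists k, kk = k.+1 by case: (kk) Kk => // k _; exists k.
rewrite kkE in kt tk Kk.
have k0 : 0 < k.+1%:R :> R by [].
have kh : k.+1%:R * `|h| <= N%:R by rewrite -ler_pdivlMr.
have Nk : N%:R < k.+2%:R * `|h| by rewrite -ltr_pdivrMr.
pose m i := Num.floor (k.+1%:R * h ord0 i).
have mP i : (m i)%:~R <= k.+1%:R * h ord0 i < (m i)%:~R + 1.
  by rewrite -intrD1 floor_itv.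
have hN i : `|k.+1%:R * h ord0 i| <= N%:R.
  by rewrite normrM gtr0_norm// (le_trans _ kh)// ler_pM2l// mx_entry_le.
have mN i : - N%:Z <= m i <= N%:Z.
  have := hN i; rewrite ler_norml => /andP[h1 h2]; apply/andP; split.
    by rewrite /m floor_ge_int ?num_real// mulrNz.
  by rewrite -(ler_int R); have /andP[h3 _] := mP i; rewrite (le_trans h3).
pose f : {ffun 'I_n -> 'I_(N + N).+1} := [ffun i => inord (absz (m i + N%:Z))].
have fm i : cof f i = m i.
  by rewrite /cof ffunE; exact: inord_shiftK.
pose y : 'rV[R]_n := \row_i (m i)%:~R.
have yE : \row_i (cof f i)%:~R = y by apply/rowP => i; rewrite !mxE fm.
have hy i : `|(h - k.+1%:R^-1 *: y) ord0 i| <= k.+1%:R^-1.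
  rewrite !mxE -[h ord0 i](mulKf (lt0r_neq0 k0)) -mulrBr normrM gtr0_norm ?invr_gt0//.
  rewrite ler_piMr// ?invr_ge0// ger0_norm; have /andP[? ?] := mP i; lra.
have lE := lz m; rewrite -/y in lE.
have := HK k (ltnW (Kk : (K < k)%N)) f; rewrite yE lE /dq.
set S := \sum_i (m i)%:~R * _; set gy := g (z + _).
move=> q1.
(* Three errors: replacing [h] by [y / (k + 1)] inside [g], the difference quotient in the integer
   direction [y], and the same replacement inside the linear map. *)
have -> : g (z + h) - g z - \sum_i h ord0 i * d i =
   (g (z + h) - gy) - k.+1%:R^-1 * (S - k.+1%:R * (gy - g z))
   - \sum_i (h - k.+1%:R^-1 *: y) ord0 i * d i.
  have -> : \sum_i (h - k.+1%:R^-1 *: y) ord0 i * d i =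
      \sum_i h ord0 i * d i - k.+1%:R^-1 * S.
    rewrite /S mulr_sumr -sumrB; apply: eq_bigr => i _; rewrite !mxE /d; ring.
  by field; rewrite gt_eqF.
have b1 : `|g (z + h) - gy| <= M * k.+1%:R^-1.
  rewrite (le_trans (gM _ _))// ler_pM2l// opprD addrACA subrr add0r.
  by apply: rV_norm_le => //; rewrite invr_ge0.
have b2 : `|k.+1%:R^-1 * (S - k.+1%:R * (gy - g z))| <= k.+1%:R^-1.
  by rewrite normrM gtr0_norm ?invr_gt0// ler_piMr// invr_ge0.
have b3 := dM' _ _ hy.
apply: (@le_trans _ _ (k.+1%:R^-1 * (C + 1))).
  rewrite (le_trans (ler_normB _ _))//.
  apply: (@le_trans _ _ (M * k.+1%:R^-1 + k.+1%:R^-1 + k.+1%:R^-1 * M')).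
    by rewrite lerD// (le_trans (ler_normB _ _))// lerD.
  by rewrite (_ : _ + _ = k.+1%:R^-1 * (C + 1)) // /C; ring.
have k2 : k.+2%:R <= 2 * k.+1%:R :> R by rewrite -natrM ler_nat leq_double_succ.
rewrite ler_pdivrMl//.
have : e * N%:R <= e * (2 * k.+1%:R * `|h|).
  by rewrite ler_pM2l// (le_trans (ltW Nk))// ler_pM2r.
move=> /(le_trans NC); rewrite -!mulrA mulrCA ler_pM2l//.
by rewrite mulrCA.
Qed.

End frechet.

(** * Rademacher's theorem for vector-valued maps *)

Section rademacher.
Context {R : realType} (n m : nat).

Lemma ae_forall_count d (T : measurableType d) (mu : {measure set T -> \bar R})
    (I : countType) (P : I -> T -> Prop) :
  (forall i, {ae mu, forall x, P i x}) -> {ae mu, forall x i, P i x}.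
Proof.
move=> aeP.
have : {ae mu, forall x k, if @unpickle I k is Some i then P i x else True}.
  apply: ae_foralln => k; case: unpickle => [i|]; first exact: aeP.
  exact: filterE.
by apply: filterS => x Px i; have := Px (pickle i); rewrite pickleK.
Qed.

(** Rows are directions and columns are components, as in ['J], so that it acts by [h *m J]. For
    Lipschitz [G] its entries are measurable and bounded everywhere, which makes them suitable
    integrands. *)
Definition jacobian_dq (G : 'rV[R]_n -> 'rV[R]_m) (z : 'rV[R]_n) : 'M[R]_(n, m) :=
  \matrix_(i, j) dirderiv (fun x => G x ord0 j) (delta_mx ord0 i) z.

Lemma mulmxr_le (J : 'M[R]_(n, m)) (h : 'rV[R]_n) :
  `|h *m J| <= (\sum_i \sum_j `|J i j|) * `|h|.
Proof.
have S0 : 0 <= \sum_i \sum_j `|J i j| by apply: sumr_ge0 => i _; exact: sumr_ge0.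
apply: rV_norm_le => [|j]; first exact: mulr_ge0.
rewrite mxE (le_trans (ler_norm_sum _ _ _))// mulr_suml ler_sum// => i _.
rewrite normrM mulrC ler_pM//; last exact: mx_entry_le.
by rewrite (bigD1 j)//= lerDl sumr_ge0.
Qed.

Lemma mulmxr_continuous (J : 'M[R]_(n, m)) : continuous (fun h : 'rV[R]_n => h *m J).
Proof.
apply: (@lipschitz_continuous _ _ _ _ (\sum_i \sum_j `|J i j|)) => x y.
by rewrite -mulmxBl mulmxr_le.
Qed.

Lemma jacobianE (G : 'rV[R]_n -> 'rV[R]_m) z (J : 'M[R]_(n, m)) :
  'd G z = (fun h => h *m J) :> ('rV[R]_n -> 'rV[R]_m) -> 'J G z = J.
Proof.
move=> dG; apply/matrixP => i j; rewrite /jacobian mxE dG.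
by rewrite -rowE mxE.
Qed.

(** Outside one null set the quotients of all components converge along all integer directions,
    linearly in the direction; at such a point [lipschitz_frechet] gives the full differential. *)
Theorem rademacher (G : 'rV[R]_n -> 'rV[R]_m) (M : R) :
  0 < M -> (forall x y, `|G x - G y| <= M * `|x - y|) ->
  {ae lam n, forall z, differentiable G z /\ 'J G z = jacobian_dq G z}.
Proof.
move=> M0 GM.
pose g (j : 'I_m) x := G x ord0 j.
have gM j x y : `|g j x - g j y| <= M * `|x - y|.
  rewrite (le_trans _ (GM x y))//.
  by have := mx_entry_le (G x - G y) j; rewrite !mxE.
(* Finite functions form a countable type, over which almost everywhere statements can be
   intersected. *)
pose c_ (c : {ffun 'I_n -> int}) : 'rV[R]_n := \row_i (c i)%:~R.
have H : {ae lam n, forall z c j, cvgn (dq (g j) (c_ c) ^~ z) /\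
    dirderiv (g j) (c_ c) z =
    \sum_i (c i)%:~R * dirderiv (g j) (delta_mx ord0 i) z}.
  apply: ae_forall_count => c; apply: filter_forall => j.
  by apply: filterS2 (ae_cvg_dq M0 (gM j) (c_ c)) (ae_dirderiv_linear M0 (gM j) c).
apply: filterS H => z Hz.
have c_E (c : 'I_n -> int) : \row_i (c i)%:~R = c_ [ffun i => c i].
  by apply/rowP => i; rewrite !mxE ffunE.
have fr j e : 0 < e -> \forall h \near (0 : 'rV[R]_n), `|g j (z + h) - g j z -
    \sum_i h ord0 i * dirderiv (g j) (delta_mx ord0 i) z| <= e * `|h|.
  apply: (lipschitz_frechet M0 (gM j)) => c; rewrite c_E; have [h1 h2] := Hz [ffun i => c i] j.
    exact: h1.
  by rewrite h2; apply: eq_bigr => i _; rewrite ffunE.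
have [] // := @frechet_diff R _ _ G z (mulmxr (jacobian_dq G z)).
- exact: mulmxr_continuous.
- move=> e e0.
  have := @filter_forall _ 'I_m (fun j (h : 'rV[R]_n) => `|g j (z + h) - g j z -
    \sum_i h ord0 i * dirderiv (g j) (delta_mx ord0 i) z| <= e * `|h|)
    _ (nbhs_filter (0 : 'rV[R]_n)) (fun j => fr j e e0).
  apply: filterS => h hj; apply: rV_norm_le => [|j]; first by rewrite mulr_ge0// ltW.
  rewrite !mxE; under eq_bigr do rewrite mxE.
  exact: hj.
- by move=> dG /jacobianE.
Qed.

End rademacher.

(** * The uniform law on the ball *)

Section euclidean_norm.
Context {R : realType} (n : nat).
Local Notation V := 'rV[R]_n.
Implicit Types x y : V.

Definition dot x y : R := \sum_i x ord0 i * y ord0 i.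

Lemma enorm_ge0 x : 0 <= enorm x.
Proof. exact: sqrtr_ge0. Qed.

Lemma enorm_sqr x : enorm x ^+ 2 = \sum_i x ord0 i ^+ 2.
Proof. by rewrite sqr_sqrtr// sumr_ge0// => i _; exact: sqr_ge0. Qed.

Lemma enorm_sqr_dot x : enorm x ^+ 2 = dot x x.
Proof. by rewrite enorm_sqr; apply: eq_bigr => i _; rewrite expr2. Qed.

Lemma dotDr x y z : dot x (y + z) = dot x y + dot x z.
Proof. by rewrite -big_split; apply: eq_bigr => i _; rewrite mxE mulrDr. Qed.

Lemma dotC x y : dot x y = dot y x.
Proof. by apply: eq_bigr => i _; rewrite mulrC. Qed.

Lemma dotZr c x y : dot x (c *: y) = c * dot x y.
Proof. by rewrite mulr_sumr; apply: eq_bigr => i _; rewrite mxE mulrCA. Qed.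

Lemma dotNr x y : dot x (- y) = - dot x y.
Proof. by rewrite -scaleN1r dotZr mulN1r. Qed.

Lemma dotBr x y z : dot x (y - z) = dot x y - dot x z.
Proof. by rewrite dotDr dotNr. Qed.

Lemma dotBl x y z : dot (x - y) z = dot x z - dot y z.
Proof. by rewrite dotC dotBr !(dotC z). Qed.

Lemma dotZl c x y : dot (c *: x) y = c * dot x y.
Proof. by rewrite dotC dotZr dotC. Qed.

Lemma enormZ c x : enorm (c *: x) = `|c| * enorm x.
Proof.
rewrite /enorm; under eq_bigr do rewrite mxE exprMn.
by rewrite -mulr_sumr sqrtrM ?sqr_ge0// sqrtr_sqr.
Qed.

Lemma enormN x : enorm (- x) = enorm x.
Proof. by rewrite -scaleN1r enormZ normrN1 mul1r. Qed.

Lemma enorm0 : enorm (0 : V) = 0.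
Proof. by rewrite -(scale0r 0) enormZ normr0 mul0r. Qed.

Lemma enorm_eq0 x : enorm x = 0 -> x = 0.
Proof.
move=> x0; have := enorm_sqr x; rewrite x0 expr0n/= => /esym/eqP.
rewrite psumr_eq0; last by move=> i _; exact: sqr_ge0.
move=> /allP h; apply/rowP => i; have := h i (mem_index_enum _).
by rewrite sqrf_eq0 mxE => /eqP.
Qed.

Lemma cauchy_schwarz x y : `|dot x y| <= enorm x * enorm y.
Proof.
have [y0|y0] := eqVneq (enorm y) 0.
  rewrite (enorm_eq0 y0) enorm0 mulr0 /dot big1 ?normr0// => i _.
  by rewrite mxE mulr0.
have {}y0 : 0 < enorm y by rewrite lt0r y0 enorm_ge0.
rewrite -ler_sqr ?nnegrE ?mulr_ge0 ?enorm_ge0// real_normK ?num_real// exprMn.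
(* Up to the factor [enorm y ^+ 2], this is the component of [x] orthogonal to [y]. *)
have := sqr_ge0 (enorm (enorm y ^+ 2 *: x - dot x y *: y)).
rewrite (enorm_sqr_dot (_ - _)) dotBr !dotZr !dotBl !dotZl -!enorm_sqr_dot (dotC y x).
set X := enorm x ^+ 2; set Y := enorm y ^+ 2; set d := dot x y.
have Y0 : 0 < Y by rewrite exprn_gt0.
have -> : Y * (Y * X - d * d) - d * (Y * d - d * Y) = Y * (X * Y - d ^+ 2) by ring.
by rewrite pmulr_rge0// subr_ge0.
Qed.

Lemma ler_enormD x y : enorm (x + y) <= enorm x + enorm y.
Proof.
rewrite -ler_sqr ?nnegrE ?addr_ge0 ?enorm_ge0//.
rewrite enorm_sqr_dot dotDr (dotC _ x) (dotC _ y) !dotDr -!enorm_sqr_dot sqrrD (dotC y x).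
have := le_trans (ler_norm _) (cauchy_schwarz x y); lra.
Qed.

(** It suffices to test with [w = x]. Norm bounds on averages are thereby reduced to scalar
    integrals. *)
Lemma enorm_dual x (c : R) : 0 <= c ->
  (forall w, dot w x <= enorm w * c) -> enorm x <= c.
Proof.
move=> c0 h; have [->//|x0] := eqVneq (enorm x) 0.
have {}x0 : 0 < enorm x by rewrite lt0r x0 enorm_ge0.
by have := h x; rewrite -enorm_sqr_dot expr2 ler_pM2l.
Qed.

Lemma norm_le_enorm x : `|x| <= enorm x.
Proof.
apply: rV_norm_le => [|i]; first exact: enorm_ge0.
rewrite -ler_sqr ?nnegrE ?enorm_ge0// real_normK ?num_real// enorm_sqr.
by rewrite (bigD1 i)//= lerDl sumr_ge0// => j _; exact: sqr_ge0.
Qed.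

Lemma enorm_le_norm x : enorm x <= Num.sqrt n%:R * `|x|.
Proof.
rewrite -ler_sqr ?nnegrE ?mulr_ge0 ?enorm_ge0 ?sqrtr_ge0//.
rewrite enorm_sqr exprMn sqr_sqrtr//.
have -> : n%:R = \sum_(i < n) (1 : R) by rewrite sumr_const card_ord.
rewrite mulr_suml ler_sum// => i _; rewrite mul1r.
rewrite -(real_normK (num_real (x ord0 i))) ler_sqr ?nnegrE//.
exact: mx_entry_le.
Qed.

End euclidean_norm.

(** * The uniform law in terms of Lebesgue measure *)

Section uniform_ball.
Context {R : realType} (n : nat).
Local Notation V := 'rV[R]_n.
Local Notation B := (@unit_ball R n).
Local Notation P := (@unif_ball R n).

Lemma lam_ball_lty : (lam n B < +oo)%E.
Proof.
apply: (@le_lt_trans _ _ (lam n (box (const_mx (- 2)) (const_mx 2 : V)))); last first.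
  exact: lebesgue_rV_box_lty.
apply: le_measure; rewrite ?inE; [exact: measurable_unit_ball|exact: measurable_box|].
move=> x /= x1 i; rewrite !mxE.
have : `|x ord0 i| <= 1 by rewrite (le_trans (mx_entry_le _ _))// (le_trans (norm_le_enorm x)).
by rewrite ler_norml => /andP[? ?]; apply/andP; split; lra.
Qed.

Lemma lam_ball_gt0 : (0 < lam n B)%E.
Proof.
(* The cube of half-side [1 / (n + 1)] lies in the ball because the square root of [n] is at most
   [n + 1]. *)
pose d : R := n.+1%:R^-1.
have d0 : 0 < d by rewrite invr_gt0.
apply: (@lt_le_trans _ _ (lam n (box (const_mx (- d)) (const_mx d : V)))).
  rewrite [X in (0 < X)%E]lebesgue_rV_box ?lte_fin; last by move=> i; rewrite !mxE; lra.
  by apply: prodr_gt0 => i _; rewrite !mxE; lra.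
apply: le_measure; rewrite ?inE; [exact: measurable_box|exact: measurable_unit_ball|].
move=> x xd; rewrite /unit_ball/=.
have xd' : `|x| <= d.
  apply: rV_norm_le => [|i]; first exact: ltW.
  by have := xd i; rewrite !mxE ler_norml => /andP[/ltW -> /ltW].
rewrite (le_trans (enorm_le_norm _))//.
apply: (@le_trans _ _ (n.+1%:R * d)); last by rewrite divff.
rewrite ler_pM ?sqrtr_ge0//.
rewrite -ler_sqr ?nnegrE ?sqrtr_ge0// sqr_sqrtr//.
by rewrite -natrX ler_nat; nia.
Qed.

Local Notation v := (fine (lam n B)).

(** The volume of the ball is positive and finite, so the default branch of [mnormalize] is never
    taken. *)
Lemma unif_ballE (A : set V) : P A = (lam n (A `&` B) * v^-1%:E)%E.
Proof.
rewrite /= /mnormalize/= /mrestr setTI.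
rewrite gt_eqF ?lam_ball_gt0//= lt_eqF//; exact: lam_ball_lty.
Qed.

Lemma unif_ballC0 : P (~` B) = 0%E.
Proof. by rewrite unif_ballE setICl measure0 mul0e. Qed.

(** Both [D] and its copy shrunk by [t] lie in the ball, where the law is a multiple of Lebesgue
    measure. *)
Lemma unif_ball_scale (t : R) (D : set V) : 0 < t -> t <= 1 -> measurable D ->
  D `<=` B -> P [set u | D (t^-1 *: u)] = ((t ^+ n)%:E * P D)%E.
Proof.
move=> t0 t1 mD DB; rewrite !unif_ballE muleA; congr (_ * _)%E.
rewrite !setIidl//; first by rewrite [LHS]lam_scale ?invr_gt0// invrK.
move=> u /= /DB; rewrite /unit_ball/= enormZ gtr0_norm ?invr_gt0//.
by rewrite ler_pdivrMl// mulr1 => /le_trans; apply.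
Qed.

Lemma unif_ball_translate (a : V) (A : set V) : measurable A ->
  A `<=` B -> A `<=` [set u | B (u - a)] ->
  P ((fun u => u + a) @^-1` A) = P A.
Proof.
move=> mA AB ABa; rewrite !unif_ballE; congr (_ * _)%E.
rewrite !setIidl//; first by rewrite [LHS]lam_translate.
by move=> u /= /ABa; rewrite /= addrK.
Qed.

Lemma unif_ball_preserve (phi : V -> V) : (forall u, enorm (phi u) = enorm u) ->
  (forall A, measurable A -> lam n (phi @^-1` A) = lam n A) ->
  forall A, measurable A -> P (phi @^-1` A) = P A.
Proof.
move=> phiB phil A mA; rewrite !unif_ballE; congr (_ * _)%E.
rewrite -[RHS]phil; last by apply: measurableI => //; exact: measurable_unit_ball.
by congr (lam n _); apply/seteqP; split=> u; rewrite /= /unit_ball/= phiB.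
Qed.

(** Absolute continuity of the law of [x + s *: u]; it carries almost everywhere statements such as
    Rademacher's theorem over to averages. *)
Lemma unif_ball_null (x : V) (s : R) (N : set V) : 0 < s -> measurable N ->
  lam n N = 0%E -> P [set u | N (x + s *: u)] = 0%E.
Proof.
move=> s0 mN N0.
have mN' : measurable [set u : V | N (x + s *: u)].
  by rewrite -[X in measurable X]setTI; exact: measurable_affine.
rewrite unif_ballE.
suff -> : lam n ([set u | N (x + s *: u)] `&` B) = 0%E by rewrite mul0e.
apply/eqP; rewrite eq_le measure_ge0 andbT.
apply: (@le_trans _ _ (lam n [set u : V | N (x + s *: u)])).
  apply: le_measure; rewrite ?inE//; apply: measurableI => //.
  exact: measurable_unit_ball.
have mNx : measurable ((fun z => z + x) @^-1` N).
  by rewrite -[X in measurable X]setTI; exact: measurable_translate.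
have -> : [set u | N (x + s *: u)] = (fun z => s *: z) @^-1` ((fun z => z + x) @^-1` N).
  by apply/seteqP; split=> u /=; rewrite addrC.
by rewrite [leLHS]lam_scale// lam_translate// N0 mule0.
Qed.

End uniform_ball.

(** * Inequalities for expectations *)

Section expectation_lemmas.
Context d (T : measurableType d) (R : realType).

Lemma Rintegral_sum (mu : {measure set T -> \bar R}) (I : Type) (s : seq I)
    (f : I -> T -> R) :
  (forall i, mu.-integrable setT (EFin \o f i)) ->
  \int[mu]_x (\sum_(i <- s) f i x) = \sum_(i <- s) \int[mu]_x f i x.
Proof.
move=> intf; elim: s => [|i s IH].
  by under eq_Rintegral do rewrite big_nil; rewrite big_nil Rintegral_cst// mul0r.
under eq_Rintegral do rewrite big_cons.
rewrite RintegralD//; first by rewrite IH big_cons.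
rewrite (_ : _ \o _ = (fun x => \sum_(j <- s) (f j x)%:E)%E).
  by apply: integrable_sum => // j _; exact: intf.
by apply/funext => x /=; rewrite sumEFin.
Qed.

Lemma Rintegral_norm_le (m : {measure set T -> \bar R}) (D : set T) (h : T -> R) (M : R) :
  measurable D -> (m D < +oo)%E -> measurable_fun setT h -> (forall x, `|h x| <= M) ->
  `|\int[m]_(x in D) h x| <= M * fine (m D).
Proof.
move=> mD mDoo mh hM.
have ih : m.-integrable D (EFin \o h) := integrable_bounded mD mDoo mh hM.
rewrite (le_trans (le_normr_Rintegral mD ih))// -Rintegral_cst//.
apply: le_Rintegral => //; first exact: integrable_norm.
apply: (integrable_bounded (B := `|M|) mD mDoo) => //; exact: measurable_cst.
Qed.

(* Both measures give the complement of [D] the same mass. *)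
Lemma Rintegral_dist_le (m1 m2 : {measure set T -> \bar R}) (D : set T) (h : T -> R) (M : R) :
  measurable D -> m1 setT = 1%E -> m2 setT = 1%E ->
  (forall A, measurable A -> A `<=` D -> m1 A = m2 A) ->
  measurable_fun setT h -> (forall x, `|h x| <= M) ->
  `|\int[m1]_x h x - \int[m2]_x h x| <= 2 * M * fine (m2 (~` D)).
Proof.
move=> mD m11 m21 m12 mh hM.
have mDC : measurable (~` D) by exact: measurableC.
have split_ (m : {measure set T -> \bar R}) : m setT = 1%E ->
   \int[m]_x h x = \int[m]_(x in D) h x + \int[m]_(x in ~` D) h x.
  move=> mT; rewrite -(setUv D) Rintegral_setU//; last exact/disj_setPCl.
  by rewrite setUv; apply: (integrable_bounded measurableT _ mh hM); rewrite mT ltry.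
have fin (m : {measure set T -> \bar R}) A : measurable A -> m setT = 1%E -> (m A < +oo)%E.
  move=> mA mT; apply: (@le_lt_trans _ _ (m setT)); last by rewrite mT ltry.
  by rewrite le_measure ?inE.
have mDE : m1 (~` D) = m2 (~` D).
  have mC (m : {measure set T -> \bar R}) : m setT = 1%E -> m (~` D) = (1 - m D)%E.
    by move=> mT; rewrite -setTD measureD//= ?setTI mT// ltry.
  by rewrite !mC// m12.
rewrite !split_// (_ : \int[m1]_(x in D) h x = \int[m2]_(x in D) h x); last first.
  by rewrite /Rintegral (eq_measure_integral m2).
rewrite opprD addrACA subrr add0r (le_trans (ler_normB _ _))//.
rewrite (_ : 2 * M * _ = M * fine (m2 (~` D)) + M * fine (m2 (~` D))); last by ring.
by apply: lerD; [rewrite -mDE|]; apply: Rintegral_norm_le => //; exact: fin.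
Qed.

(** The variance of the absolute value of [X] is nonnegative. *)
Lemma Rintegral_norm_sqr (m : {measure set T -> \bar R}) (X : T -> R) :
  m setT = 1%E -> m.-integrable setT (EFin \o X) ->
  m.-integrable setT (EFin \o (fun x => X x ^+ 2)) ->
  (\int[m]_x `|X x|) ^+ 2 <= \int[m]_x (X x ^+ 2).
Proof.
move=> m1 iX iX2; set c := \int[m]_x `|X x|.
have inX : m.-integrable setT (EFin \o (fun x => `|X x|)) by exact: integrable_norm.
have inX2 : m.-integrable setT (EFin \o (fun x => 2 * c * `|X x|)).
  exact: (integrableZl measurableT (2 * c) inX).
have : 0 <= \int[m]_x (`|X x| - c) ^+ 2 by apply: Rintegral_ge0 => x _; exact: sqr_ge0.
have -> : \int[m]_x (`|X x| - c) ^+ 2 = \int[m]_x ((X x ^+ 2 - 2 * c * `|X x|) + c ^+ 2).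
  apply: eq_Rintegral => x _; rewrite sqrrB real_normK ?num_real//; ring.
rewrite RintegralD//; first last.
- apply/integrableP; split; first exact: measurable_cst.
  by rewrite /= integral_cst// m1 mule1 ltry.
- exact: (integrableB measurableT iX2 inX2).
rewrite RintegralB// RintegralZl// Rintegral_cst// m1 -/c/= mulr1; lra.
Qed.

End expectation_lemmas.

(** * Moments of a uniform point of the ball *)

Section ball_moments.
Context {R : realType} (n : nat).
Local Notation V := 'rV[R]_n.
Local Notation B := (@unit_ball R n).
Local Notation P := (@unif_ball R n).

Lemma unif_ball_integrable (f : V -> R) (K : R) : measurable_fun setT f ->
  (forall u, enorm u <= 1 -> `|f u| <= K) -> P.-integrable setT (EFin \o f).
Proof.
move=> mf fK.
have mB := @measurable_unit_ball R n.
have mEf : measurable_fun setT (EFin \o f) by exact/measurable_EFinP.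
have [_ ] := @negligible_integrable _ _ _ P setT (~` B) (EFin \o f)
  (measurableC mB) measurableT mEf (@unif_ballC0 R n).
apply; rewrite setTD setCK.
apply: measurable_bounded_integrable => //.
- by rewrite (@le_lt_trans _ _ 1%E) ?ltry//; exact: probability_le1.
- exact: measurable_funTS.
exists K; split; first exact: num_real.
by move=> x Kx u Bu /=; exact: le_trans (fK u Bu) (ltW Kx).
Qed.

Lemma le_Rintegral_ball (f g : V -> R) : P.-integrable setT (EFin \o f) ->
  P.-integrable setT (EFin \o g) -> (forall u, enorm u <= 1 -> f u <= g u) ->
  \int[P]_u f u <= \int[P]_u g u.
Proof.
move=> intf intg fg.
have mB := @measurable_unit_ball R n.
have E h : P.-integrable setT (EFin \o h) -> \int[P]_u h u = \int[P]_(u in B) h u.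
  move=> ih.
  rewrite /Rintegral (negligible_integral (measurableC mB) measurableT ih) ?setTD ?setCK//.
  exact: unif_ballC0.
rewrite !E//; apply: le_Rintegral => //.
- exact: integrableS intf.
- exact: integrableS intg.
Qed.

Lemma Rintegral_preserve (phi : V -> V) (f : V -> R) (K : R) :
  measurable_fun setT phi -> (forall u, enorm (phi u) = enorm u) ->
  (forall A, measurable A -> lam n (phi @^-1` A) = lam n A) ->
  measurable_fun setT f -> (forall u, enorm u <= 1 -> `|f u| <= K) ->
  \int[P]_u f (phi u) = \int[P]_u f u.
Proof.
move=> mphi phiB phil mf fK.
have mEf : measurable_fun setT (EFin \o f) by exact/measurable_EFinP.
have iphi : P.-integrable setT ((EFin \o f) \o phi).
  apply: (@unif_ball_integrable (f \o phi) K); first exact: (measurableT_comp mf).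
  by move=> u u1; apply: fK; rewrite phiB.
pose pm0 := (pushforward P phi : {measure set V -> \bar R}).
rewrite /Rintegral; congr fine.
have := integral_pushforward mphi mEf iphi measurableT.
rewrite preimage_setT => /= <-.
rewrite -/(pm0 mphi); apply: (eq_measure_integral P (m1 := pm0 mphi)) => A mA _.
exact: unif_ball_preserve.
Qed.

Lemma coord_ball (u : V) i : enorm u <= 1 -> `|u ord0 i| <= 1.
Proof. by move=> u1; rewrite (le_trans (mx_entry_le _ _))// (le_trans (norm_le_enorm u)). Qed.

Lemma measurable_coordM i j : measurable_fun setT (fun u : V => u ord0 i * u ord0 j).
Proof. by apply: measurable_funM; exact: measurable_rV_coord. Qed.

Lemma coordM_ball i j (u : V) : enorm u <= 1 -> `|u ord0 i * u ord0 j| <= 1.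
Proof. by move=> u1; rewrite normrM mulr_ile1// coord_ball. Qed.

(* Reflecting the i-th coordinate changes the sign of the integrand. *)
Lemma Rintegral_coordM0 i j : i != j -> \int[P]_u (u ord0 i * u ord0 j) = 0.
Proof.
move=> ij.
pose phi (x : V) : V := \row_k (if k == i then - x ord0 k else x ord0 k).
have := @Rintegral_preserve phi (fun u => u ord0 i * u ord0 j) 1.
move=> /(_ _ _ _ _ _)/wrap[].
- apply: measurable_coordwise => k; case: eqP => _; last exact: measurable_rV_coord.
  by apply: measurable_funN; exact: measurable_rV_coord.
- move=> u; rewrite /enorm; congr Num.sqrt; apply: eq_bigr => k _.
  by rewrite mxE; case: ifP => _; rewrite ?sqrrN.
- by move=> A mA; exact: lam_flip.
- exact: measurable_coordM.
- exact: coordM_ball.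
under eq_Rintegral do rewrite !mxE eqxx (negbTE (_ : j != i)) 1?eq_sym// mulNr -mulN1r.
rewrite RintegralZl//; first lra.
by apply: (@unif_ball_integrable _ 1); [exact: measurable_coordM|exact: coordM_ball].
Qed.

(** Exchanging the coordinates [i] and [j] preserves the law. *)
Lemma Rintegral_coord_sqr i j :
  \int[P]_u (u ord0 i * u ord0 i) = \int[P]_u (u ord0 j * u ord0 j).
Proof.
pose s k := if k == i then j else if k == j then i else k.
have sK : cancel s s.
  move=> k; rewrite /s; case: (eqVneq k i) => [->|ki].
    by rewrite eqxx; case: eqVneq => // ->.
  by case: (eqVneq k j) => [->|kj]; rewrite ?eqxx// (negbTE ki) (negbTE kj).
pose phi (x : V) : V := \row_k x ord0 (s k).
have := @Rintegral_preserve phi (fun u => u ord0 i * u ord0 i) 1.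
move=> /(_ _ _ _ _ _)/wrap[].
- by apply: measurable_coordwise => k; exact: measurable_rV_coord.
- move=> u; rewrite /enorm; congr Num.sqrt; rewrite [RHS](reindex_inj (can_inj sK)).
  by apply: eq_bigr => k _; rewrite mxE.
- by move=> A mA; exact: (lam_perm sK sK).
- exact: measurable_coordM.
- exact: coordM_ball.
by under eq_Rintegral do rewrite !mxE {1 2}/s eqxx.
Qed.

Lemma integrable_coordM i j : P.-integrable setT (EFin \o (fun u : V => u ord0 i * u ord0 j)).
Proof. by apply: (@unif_ball_integrable _ 1); [exact: measurable_coordM|exact: coordM_ball]. Qed.

(** The [n] second moments are equal and add up to the mean of [enorm u ^+ 2], which is at most
    1. *)
Lemma Rintegral_coord_sqr_le i : \int[P]_u (u ord0 i * u ord0 i) <= n%:R^-1.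
Proof.
have n0 : 0 < n%:R :> R by rewrite ltr0n; case: i => m; case: (n).
rewrite -(ler_pM2l n0) divff ?gt_eqF//.
have -> : n%:R * \int[P]_u (u ord0 i * u ord0 i) =
    \int[P]_u (\sum_k u ord0 k * u ord0 k).
  rewrite Rintegral_sum; last by move=> k; exact: integrable_coordM.
  under [RHS]eq_bigr => k _ do rewrite (Rintegral_coord_sqr k i).
  by rewrite sumr_const card_ord mulr_natl.
have i1 : P.-integrable setT (EFin \o (fun u : V => \sum_k u ord0 k * u ord0 k)).
  rewrite (_ : _ \o _ = (fun u : V => \sum_k (u ord0 k * u ord0 k)%:E)%E).
    by apply: integrable_sum => // j _; exact: integrable_coordM.
  by apply/funext => x /=; rewrite sumEFin.
rewrite [leRHS](_ : 1 = \int[P]_u (1 : R)); last first.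
  by rewrite Rintegral_cst// [X in fine X]probability_setT mulr1.
apply: le_Rintegral_ball => //.
  by apply: (@unif_ball_integrable _ 1) => // *; rewrite normr1.
move=> u u1; rewrite -[leLHS]/(dot u u) -enorm_sqr_dot.
by rewrite expr_le1// enorm_ge0.
Qed.

Lemma measurable_dot (a : V) : measurable_fun setT (fun u : V => dot a u).
Proof.
apply: measurable_sum => i; apply: measurable_funM => //; exact: measurable_rV_coord.
Qed.

Lemma dot_ball (a u : V) : enorm u <= 1 -> `|dot a u| <= enorm a.
Proof. by move=> u1; rewrite (le_trans (cauchy_schwarz _ _))// ler_piMr// enorm_ge0. Qed.

Lemma integrable_dot (a : V) : P.-integrable setT (EFin \o (fun u => dot a u)).
Proof. by apply: (@unif_ball_integrable _ (enorm a)); [exact: measurable_dot|exact: dot_ball]. Qed.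

(** The first moment is bounded by the second. In the expansion of the latter the mixed terms
    vanish, and each square contributes at most [a_i ^+ 2 / n]. *)
Lemma Rintegral_dot_le (a : V) : (0 < n)%N ->
  \int[P]_u `|dot a u| <= enorm a / Num.sqrt n%:R.
Proof.
move=> n0.
have sn0 : 0 < Num.sqrt n%:R :> R by rewrite sqrtr_gt0 ltr0n.
rewrite -ler_sqr ?nnegrE; first last.
- by rewrite divr_ge0 ?enorm_ge0// ltW.
- by apply: Rintegral_ge0.
rewrite (le_trans (Rintegral_norm_sqr _ (integrable_dot a) _))//.
- exact: probability_setT.
- apply: (@unif_ball_integrable _ (enorm a ^+ 2)).
    by apply: measurable_funX; exact: measurable_dot.
  move=> u u1; rewrite normrX ler_sqr ?nnegrE ?enorm_ge0//; exact: dot_ball.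
under eq_Rintegral do rewrite expr2 {1}/dot mulr_suml.
rewrite Rintegral_sum; last first.
  move=> i; apply: (@unif_ball_integrable _ (`|a ord0 i| * enorm a)).
    apply: measurable_funM; last exact: measurable_dot.
    by apply: measurable_funM => //; exact: measurable_rV_coord.
  by move=> u u1; rewrite !normrM ler_pM ?dot_ball// ler_piMr// coord_ball.
rewrite exprMn enorm_sqr mulr_suml ler_sum// => i _.
have -> : \int[P]_u (a ord0 i * u ord0 i * dot a u) =
    \int[P]_u (\sum_j (a ord0 i * a ord0 j) * (u ord0 i * u ord0 j)).
  apply: eq_Rintegral => u _; rewrite /dot mulr_sumr; apply: eq_bigr => j _; ring.
rewrite Rintegral_sum; last first.
  by move=> j; exact: (integrableZl measurableT _ (integrable_coordM i j)).
rewrite (bigD1 i)//= big1 => [|j ji]; last first.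
  rewrite RintegralZl//; last exact: integrable_coordM.
  by rewrite Rintegral_coordM0 ?mulr0// eq_sym.
rewrite addr0 RintegralZl//; last exact: integrable_coordM.
rewrite -expr2 ler_wpM2l ?sqr_ge0// exprVn sqr_sqrtr//.
exact: Rintegral_coord_sqr_le.
Qed.

End ball_moments.

Lemma integral_onemXn (R : realType) (n : nat) :
  (\int[@lebesgue_measure R]_(t in `[0%R, 1%R]%classic) ((1 - t) ^+ n)%:E = (n.+1%:R^-1)%:E)%E.
Proof.
have := @Rintegral_onemXn R n; rewrite /Rintegral.
have fin : (\int[@lebesgue_measure R]_(t in `[0%R, 1%R]%classic) ((1 - t) ^+ n)%:E)%E \is a fin_num.
  apply: integrable_fin_num => //.
  apply: continuous_compact_integrable; first exact: segment_compact.
  by apply: continuous_subspaceT => x; exact: continuous_onemXn.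
by move=> h; rewrite -(fineK fin); congr _%:E; exact: h.
Qed.

(** * The mass lost by the ball under a small translation *)

Section translated_ball.
Context {R : realType} (n : nat).
Context (n0 : (0 < n)%N).
Local Notation V := 'rV[R]_n.
Local Notation B := (@unit_ball R n).
Local Notation P := (@unif_ball R n).
Context (a : V).

(** Translation by [- a] changes the squared norm of [u] by [- 2 <a, u> + |a|^2]. The factor
    [enorm u] makes the bound homogeneous of degree 1, and its coefficient 2 makes up for it when
    [enorm u] exceeds [1 / 2]. *)
Definition excess (u : V) : R := 2 * `|dot a u| + 2 * enorm a ^+ 2 * enorm u.

(* The sublevel set [gauge <= 1] is a star body inside the intersection of the
   unit ball with its translate by [a], provided [enorm a <= 1 / 2]. *)
Definition gauge (u : V) : R := enorm u + excess u.

Lemma excess_ge0 u : 0 <= excess u.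
Proof. by rewrite addr_ge0// !mulr_ge0// ?exprn_ge0 ?enorm_ge0. Qed.

Lemma gaugeZ c u : 0 <= c -> gauge (c *: u) = c * gauge u.
Proof. by move=> c0; rewrite /gauge /excess !enormZ dotZr normrM !(ger0_norm c0); ring. Qed.

Lemma measurable_excess : measurable_fun setT excess.
Proof.
apply: measurable_funD; apply: measurable_funM => //.
  by apply: measurableT_comp => //; exact: measurable_dot.
exact: measurable_enorm.
Qed.

Lemma measurable_gauge : measurable_fun setT gauge.
Proof. by apply: measurable_funD; [exact: measurable_enorm|exact: measurable_excess]. Qed.

Definition shell : set V := B `&` [set u | 1 < gauge u].

Lemma measurable_shell : measurable shell.
Proof.
apply: measurableI; first exact: measurable_unit_ball.
rewrite (_ : [set u | 1 < gauge u] = ~` (setT `&` [set u | gauge u <= 1])).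
  by apply: measurableC; apply: measurable_fun_le => //; exact: measurable_gauge.
by rewrite setTI; apply/seteqP; split=> u /=; rewrite real_ltNge ?num_real//; move/negP.
Qed.

(** If [enorm u <= 1 / 2], the triangle inequality suffices. Otherwise
    [|u - a|^2 = |u|^2 - 2 <a, u> + |a|^2] is at most [gauge u]. *)
Lemma gauge_translate u : enorm a <= 1 / 2 -> gauge u <= 1 -> B (u - a).
Proof.
move=> a2 gu; rewrite /unit_ball/=.
have a0 := enorm_ge0 a; have u0 := enorm_ge0 u; have d0 := normr_ge0 (dot a u).
have [um|um] := leP (enorm u) (1 / 2).
  by rewrite (le_trans (ler_enormD _ _))// enormN; lra.
rewrite -(@expr_le1 _ 2)// ?enorm_ge0//.
rewrite enorm_sqr_dot dotBr !dotBl -!enorm_sqr_dot (dotC u a).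
have := ler_norm (- dot a u); rewrite normrN => ad.
rewrite /gauge /excess in gu.
have h1 : enorm u ^+ 2 <= enorm u.
  by rewrite expr2 ler_piMr// ; nra.
have h2 : enorm a ^+ 2 <= 2 * enorm a ^+ 2 * enorm u.
  have := exprn_ge0 2 a0; nra.
lra.
Qed.

(** The norm and the gauge are both homogeneous, so this set is the shell scaled by [t]. *)
Lemma shell_layer t : 0 < t -> t <= 1 ->
  P [set u | enorm u <= t /\ t < gauge u] = ((t ^+ n)%:E * P shell)%E.
Proof.
move=> t0 t1; rewrite -unif_ball_scale//; last 2 first.
- exact: measurable_shell.
- by move=> u [].
have ti0 : 0 <= t^-1 by rewrite invr_ge0 ltW.
congr (P _); apply/seteqP; split=> u /=; rewrite /shell/= /unit_ball/= (gaugeZ _ ti0);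
  by rewrite enormZ (ger0_norm ti0) ler_pdivrMl// ltr_pdivlMl// mulr1.
Qed.

Definition layers : set (V * measurableTypeR R) :=
  [set p | [/\ p.2 \in `[0, 1]%R, enorm p.1 <= 1 - p.2 & 1 - p.2 < gauge p.1]].

Lemma measurable_layers : measurable layers.
Proof.
have m1 (f : V -> R) : measurable_fun setT f ->
    measurable_fun setT (fun p : V * measurableTypeR R => f p.1).
  by move=> mf; exact: (measurableT_comp mf measurable_fst).
have m2 : measurable_fun setT (fun p : V * measurableTypeR R => 1 - p.2 : R).
  by apply: measurable_funB => //; exact: measurable_snd.
have -> : layers = (setT `&` (@snd V (measurableTypeR R)) @^-1` `[0, 1]%classic) `&`
    ((setT `&` [set p | enorm p.1 <= 1 - p.2]) `&`
     ~` (setT `&` [set p | gauge p.1 <= 1 - p.2])).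
  rewrite !setTI; apply/seteqP; split=> p /=.
    by move=> [? ? h]; split=> //; split=> //; apply/negP; rewrite -real_ltNge ?num_real.
  by move=> [? [? /negP]]; rewrite -real_ltNge ?num_real.
apply: measurableI.
  by apply: (@measurable_snd _ _ V (measurableTypeR R) measurableT); exact: measurable_itv.
apply: measurableI; first by apply: measurable_fun_le => //; apply: m1; exact: measurable_enorm.
by apply: measurableC; apply: measurable_fun_le => //; apply: m1; exact: measurable_gauge.
Qed.

(* Fubini on [layers]: the slice at height [t] is the shell shrunk by [1 - t], of
   mass [(1 - t)^n P shell]; the fibre over [u] has length at most [excess u]. *)
Lemma unif_ball_shell_le :
  (P shell * (n.+1%:R^-1)%:E <= \int[P]_u (excess u)%:E)%E.
Proof.
have mL := measurable_layers.
have : (\int[P]_x (lebesgue_measure \o xsection layers) x =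
    \int[lebesgue_measure]_y (P \o ysection layers) y)%E.
  pose mP : {sigma_finite_measure set V -> \bar R} := P.
  have := @indic_fubini_tonelli _ _ V (measurableTypeR R) R mP lebesgue_measure layers mL.
  by rewrite indic_fubini_tonelli_FE// (@indic_fubini_tonelli_GE _ _ _ _ _ mP layers mL).
have -> : (\int[lebesgue_measure]_y (P \o ysection layers) y = P shell * (n.+1%:R^-1)%:E)%E.
  rewrite -integral_onemXn -ge0_integralZl//; first last.
  - by move=> t; rewrite /= in_itv/= => /andP[? ?]; rewrite lee_fin exprn_ge0// subr_ge0.
  - apply/measurable_EFinP; apply: measurable_funX; exact: measurable_funB.
  rewrite [RHS]integral_mkcond; apply: eq_integral => t _ /=; rewrite patchE.
  case: ifPn; rewrite ?inE ?notin_setE /= => t01.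
    have -> : ysection layers t = [set u | enorm u <= 1 - t /\ 1 - t < gauge u].
      by apply/seteqP; split=> u; rewrite /ysection/= inE; [case|move=> [? ?]; split].
    move: t01; rewrite in_itv/= => /andP[t0 t1].
    have [{}t1|t1'] := ltP t 1.
      by rewrite shell_layer ?subr_gt0// 1?muleC// lerBlDr lerDl.
    (* At height 1 only [u = 0] could belong to the slice, but its gauge is [0]; the other side
       vanishes since [n > 0]. *)
    have -> : t = 1 by apply/eqP; rewrite eq_le t1.
    rewrite subrr expr0n eqn0Ngt n0/= mule0.
    rewrite (_ : [set _ | _] = set0) ?measure0//; rewrite -subset0 => u /= [u0].
    have {}u0 : u = 0 by apply: enorm_eq0; apply/eqP; rewrite eq_le u0 enorm_ge0.
    have g0 : gauge 0 = 0 by have := @gaugeZ 0 0 (lexx 0); rewrite scale0r mul0r.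
    by rewrite u0 g0 ltxx.
  rewrite (_ : ysection _ _ = set0) ?measure0//; rewrite -subset0 => u.
  by rewrite /ysection/= inE => -[].
move=> <-; apply: ge0_le_integral => //.
- exact: measurable_fun_xsection.
- by apply/measurable_EFinP; exact: measurable_excess.
move=> u _ /=.
(* The fibre over [u] lies in this interval, whose length is [gauge u - enorm u = excess u]. *)
apply: (@le_trans _ _ (lebesgue_measure
  (`]1 - gauge u, 1 - enorm u]%classic : set (measurableTypeR R)))).
  apply: le_measure; rewrite ?inE; [exact: measurable_xsection|exact: measurable_itv|].
  move=> t; rewrite /xsection/= inE/= => -[_ /= h1 h2]; rewrite in_itv/=; apply/andP; split; lra.
rewrite lebesgue_measure_itv/= lte_fin; case: ifP => _; rewrite ?lee_fin//.
  by rewrite /gauge; lra.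
exact: excess_ge0.
Qed.

(** Apart from the null complement of the ball, the points that leave lie in the shell, whose mass
    is at most [n + 1] times the mean excess. *)
Lemma unif_ball_translate_compl :
  (P [set u | ~ B (u - a)%R] <= (8 * Num.sqrt n%:R * enorm a)%:E)%E.
Proof.
have sn0 : 0 < Num.sqrt n%:R :> R by rewrite sqrtr_gt0 ltr0n.
have sn2 : Num.sqrt n%:R ^+ 2 = n%:R :> R by rewrite sqr_sqrtr.
have sn1 : 1 <= Num.sqrt n%:R :> R.
  by rewrite -(@expr_ge1 _ 2)// ?sn2 ?ler1n// ltW.
have a0 := enorm_ge0 a.
have mL : measurable [set u : V | ~ B (u - a)].
  apply: measurableC; rewrite -[X in measurable X]setTI.
  by apply: measurable_translate => //; exact: measurable_unit_ball.
(* For a large translation the claimed bound is at least 4, and a probability is at most 1. *)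
have [big|small] := leP (1 / 2) (Num.sqrt n%:R * enorm a).
  apply: (@le_trans _ _ 1%E); first exact: probability_le1.
  by rewrite lee_fin; lra.
have a2 : enorm a <= 1 / 2 by nra.
have n1 : n.+1%:R <= 2 * n%:R :> R by rewrite -natrM ler_nat; lia.
have sub : [set u | ~ B (u - a)] `<=` shell `|` ~` B.
  move=> u /= h; have [Bu|nBu] := pselect (B u); [left|by right].
  split=> //=; rewrite real_ltNge ?num_real//; apply/negP => gu.
  by apply: h; exact: gauge_translate.
have mBC : measurable (~` B) by apply: measurableC; exact: measurable_unit_ball.
apply: (@le_trans _ _ (P shell)).
  apply: (@le_trans _ _ (P (shell `|` ~` B))).
    by apply: le_measure; rewrite ?inE//; apply: measurableU => //; exact: measurable_shell.
  apply: (le_trans (measureU2 _ _ _)) => //; first exact: measurable_shell.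
  by rewrite [X in (_ + X)%E]unif_ballC0 adde0.
have iE : P.-integrable setT (EFin \o excess).
  apply: (@unif_ball_integrable _ _ _ (2 * enorm a + 2 * enorm a ^+ 2)).
    exact: measurable_excess.
  move=> u u1; rewrite ger0_norm ?excess_ge0// lerD//; first by rewrite ler_pM2l// dot_ball.
  by rewrite ler_piMr// mulr_ge0// sqr_ge0.
have Ele : \int[P]_u excess u <= 2 * (enorm a / Num.sqrt n%:R) + 2 * enorm a ^+ 2.
  have id : P.-integrable setT (EFin \o (fun u => `|dot a u|)).
    by apply: integrable_norm; exact: integrable_dot.
  have ie : P.-integrable setT (EFin \o (@enorm R n)).
    apply: (@unif_ball_integrable _ _ _ 1); first exact: measurable_enorm.
    by move=> u u1; rewrite ger0_norm// enorm_ge0.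
  rewrite RintegralD//; last 2 first.
  - exact: (integrableZl measurableT 2 id).
  - exact: (integrableZl measurableT _ ie).
  rewrite !RintegralZl// lerD//; first by rewrite ler_pM2l// Rintegral_dot_le.
  rewrite ler_piMr// ?mulr_ge0// ?sqr_ge0//.
  apply: (@le_trans _ _ (\int[P]_u (1 : R))); last first.
    by rewrite Rintegral_cst// [X in fine X]probability_setT mulr1.
  apply: le_Rintegral_ball => //.
  by apply: (@unif_ball_integrable _ _ _ 1) => // *; rewrite normr1.
have := unif_ball_shell_le.
have -> : (\int[P]_u (excess u)%:E = (\int[P]_u excess u)%:E)%E.
  by rewrite fineK//; exact: integrable_fin_num.
have Pfin : P shell \is a fin_num by apply: fin_num_measure; exact: measurable_shell.
rewrite -(fineK Pfin) -EFinM !lee_fin ler_pdivrMr// => h.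
apply: (le_trans h); set s := Num.sqrt n%:R in sn0 sn2 sn1 small Ele *.
(* Smallness of [s * enorm a] absorbs the quadratic term: the mean excess is at most [3 |a| / s],
   and [n + 1 <= 2 n] turns this into [6 s |a|]. *)
have h3 : enorm a ^+ 2 <= enorm a / s / 2.
  rewrite expr2 -mulrA ler_wpM2l// -invfM -[leRHS]mul1r ler_pdivlMr ?mulr_gt0//; nra.
apply: (@le_trans _ _ (3 * (enorm a / s) * n.+1%:R)).
  by rewrite ler_wpM2r//; lra.
apply: (@le_trans _ _ (3 * (enorm a / s) * (2 * n%:R))).
  by rewrite ler_wpM2l// mulr_ge0// divr_ge0// ltW.
rewrite -sn2; have -> : 3 * (enorm a / s) * (2 * s ^+ 2) = 6 * (s * enorm a).
  by field; rewrite gt_eqF.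
have := mulr_ge0 (ltW sn0) a0; lra.
Qed.

(** The laws of [u] and [u + a] agree on subsets of the ball intersected with its translate by [a].
    The factor 16 is twice the constant 8 of [unif_ball_translate_compl]. *)
Lemma Rintegral_translate_le (h : V -> R) (M : R) : measurable_fun setT h ->
  (forall u, `|h u| <= M) ->
  `|\int[P]_u h (u + a) - \int[P]_u h u| <= 16 * M * Num.sqrt n%:R * enorm a.
Proof.
move=> mh hM; have mt := measurable_translate a.
have M0 : 0 <= M by exact: le_trans (normr_ge0 (h 0)) (hM 0).
pose pm0 := (pushforward P (fun u => u + a) : {measure set V -> \bar R}).
have mL : measurable [set u : V | B (u - a)].
  rewrite -[X in measurable X]setTI.
  by apply: measurable_translate => //; exact: measurable_unit_ball.
pose D := B `&` [set u | B (u - a)].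
have mD : measurable D by apply: measurableI => //; exact: measurable_unit_ball.
have -> : \int[P]_u h (u + a) = \int[pm0 mt]_u h u.
  rewrite /Rintegral; congr fine.
  have ih : P.-integrable setT ((EFin \o h) \o (fun u => u + a)).
    apply: (@unif_ball_integrable _ _ (fun u => h (u + a)) M); last by move=> *; exact: hM.
    exact: (measurableT_comp mh).
  have mEh : measurable_fun setT (EFin \o h) by exact/measurable_EFinP.
  by have := integral_pushforward mt mEh ih measurableT; rewrite preimage_setT => <-.
apply: (le_trans (Rintegral_dist_le (D := D) mD _ _ _ mh hM)).
- by rewrite /= /pushforward preimage_setT; exact: probability_setT.
- exact: probability_setT.
- move=> A mA AD; rewrite /= /pushforward unif_ball_translate//.
    by move=> u /AD[].
  by move=> u /AD[].
have mDC : measurable (~` D) by exact: measurableC.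
have PD : (P (~` D) <= (8 * Num.sqrt n%:R * enorm a)%:E)%E.
  apply: le_trans unif_ball_translate_compl.
  rewrite setCI; apply: (le_trans (measureU2 _ _ _)); [|exact: measurableC|].
    by apply: measurableC; exact: measurable_unit_ball.
  by rewrite [X in (X + _)%E]unif_ballC0 add0e.
have Pfin : P (~` D) \is a fin_num by exact: fin_num_measure.
move: PD; rewrite -(fineK Pfin) lee_fin => PD.
apply: (@le_trans _ _ (2 * M * (8 * Num.sqrt n%:R * enorm a))).
  by rewrite ler_wpM2l// mulr_ge0.
by rewrite le_eqVlt; apply/orP; left; apply/eqP; ring.
Qed.

End translated_ball.

(** * Integrals of functions that agree off a null set *)

Section integral_null.
Context d (T : measurableType d) (R : realType) (mu : {measure set T -> \bar R}).
Import HBNNSimple.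

(* No measurability is assumed on the integrands: in these lemmas an integral
   is a supremum over the simple functions below the integrand. *)
Lemma ge0_le_integral_null (N : set T) (f g : T -> \bar R) :
  measurable N -> mu N = 0%E -> (forall x, 0 <= f x)%E -> (forall x, 0 <= g x)%E ->
  (forall x, ~ N x -> f x <= g x)%E -> (\int[mu]_x f x <= \int[mu]_x g x)%E.
Proof.
move=> mN N0 f0 g0 fg; rewrite !ge0_integralTE//.
apply: ge_ereal_sup => _ [h /= hf <-].
(* Setting [h] to zero on [N] keeps its integral and puts it below [g] everywhere. *)
pose h' := proj_nnsfun h (measurableC mN).
have -> : sintegral mu h = sintegral mu h'.
  rewrite -!integralT_nnsfun; apply: ge0_ae_eq_integral => //.
  - by apply/measurable_EFinP.
  - by apply/measurable_EFinP.
  - by move=> x _; rewrite lee_fin.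
  - by move=> x _; rewrite lee_fin.
  exists N; split => // x /=; apply: contra_notP => nN _.
  by rewrite /h'/= mindicE mem_set ?mulr1.
apply: ereal_sup_ubound; exists h' => //= x.
rewrite /h'/= mindicE; case: (boolP (x \in ~` N)) => xN; last by rewrite mulr0.
by rewrite mulr1 (le_trans (hf x))// fg//; rewrite inE in xN.
Qed.

Lemma integral_null_eq (N : set T) (f g : T -> \bar R) :
  measurable N -> mu N = 0%E -> (forall x, ~ N x -> f x = g x) ->
  (\int[mu]_x f x = \int[mu]_x g x)%E.
Proof.
move=> mN N0 fg.
have fgp x : ~ N x -> (f^\+ x = g^\+ x)%E by move=> nx; rewrite funepos.unlock fg.
have fgn x : ~ N x -> (f^\- x = g^\- x)%E by move=> nx; rewrite funeneg.unlock fg.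
rewrite integralE [RHS]integralE; congr (_ - _)%E;
  apply/eqP; rewrite eq_le; apply/andP; split;
  apply: (ge0_le_integral_null mN N0) => // x nx; by rewrite ?fgp ?fgn.
Qed.

End integral_null.

(** * Smooth functions and their averages *)

Section gradient_calculus.
Context {R : realType} (n : nat).
Local Notation V := 'rV[R]_n.
Implicit Types (f : V -> R) (x h v w : V).

Lemma diff_gradient f x h : differentiable f x -> 'd f x h = dot (gradient f x) h.
Proof.
move=> df; rewrite {1}(row_sum_delta h) linear_sum; apply: eq_bigr => i _.
by rewrite linearZ /gradient mxE mulrC.
Qed.

Lemma line_is_derive f x h (t : R) : differentiable f (x + t *: h) ->
  is_derive t 1 (fun s => f (x + s *: h)) (dot (gradient f (x + t *: h)) h).
Proof.
move=> df; rewrite -diff_gradient// -deriveE//.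
have E : (fun s : R => s^-1 *: (((fun r => f (x + r *: h)) \o shift t) (s *: 1) - f (x + t *: h))) =
    (fun s : R => s^-1 *: ((f \o shift (x + t *: h)) (s *: h) - f (x + t *: h))).
  apply/funext => s /=; congr (_ *: (f _ - _)).
  have -> : s *: (1 : R) = s by rewrite /GRing.scale/= mulr1.
  by rewrite scalerDl addrCA.
have dv : derivable f (x + t *: h) h by exact: diff_derivable.
apply: DeriveDef.
  by rewrite /derivable E.
by rewrite /derive E.
Qed.

Lemma line_MVT f x h : (forall z, differentiable f z) ->
  exists2 t : R, 0 <= t <= 1 & f (x + h) - f x = dot (gradient f (x + t *: h)) h.
Proof.
move=> df.
have D (t : R) : is_derive t 1 (fun s => f (x + s *: h)) (dot (gradient f (x + t *: h)) h).
  exact: line_is_derive.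
have [|t] := MVT_segment ler01 (fun t _ => D t).
  apply: continuous_subspaceT => t; apply: differentiable_continuous.
  by apply/derivable1_diffP; have [] := D t.
rewrite in_itv/= scale1r scale0r addr0 subr0 mulr1 => t01 E.
by exists t.
Qed.

(** The mean value theorem is applied once, to the difference of the two line functions, so that
    both gradients are taken at the same [t]. *)
Lemma line_MVT_shift f x h a : (forall z, differentiable f z) ->
  exists2 t : R, 0 <= t <= 1 & f (x + a + h) - f (x + a) - (f (x + h) - f x) =
    dot (gradient f (x + t *: h + a) - gradient f (x + t *: h)) h.
Proof.
move=> df.
have D (t : R) : is_derive t 1
    ((fun s => f (x + a + s *: h)) - (fun s => f (x + s *: h)))
    (dot (gradient f (x + t *: h + a) - gradient f (x + t *: h)) h).
  rewrite dotBl (addrAC x).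
  by apply: is_deriveB; exact: line_is_derive.
have [|t] := MVT_segment ler01 (fun t _ => D t).
  apply: continuous_subspaceT => t; apply: differentiable_continuous.
  by apply/derivable1_diffP; have [] := D t.
rewrite in_itv/= !fctE scale1r scale0r !addr0 subr0 mulr1 => t01 E.
by exists t => //; rewrite -E; ring.
Qed.

(** The mean value theorem yields the constant [L] instead of the sharp [L / 2]; any quadratic bound
    uniform in [x] serves for averaging. *)
Lemma smooth_taylor f (L : R) x h : smooth L f ->
  `|f (x + h) - f x - dot (gradient f x) h| <= L * enorm h ^+ 2.
Proof.
move=> [df fL]; have [t /andP[t0 t1] ->] := line_MVT x h df.
rewrite -dotBl (le_trans (cauchy_schwarz _ _))// expr2 mulrA ler_wpM2r ?enorm_ge0//.
rewrite (le_trans (fL _ _))// addrAC subrr add0r enormZ ger0_norm//.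
have L0 : 0 <= L * enorm h.
  by have := le_trans (enorm_ge0 _) (fL (x + h) x); rewrite [x + h - x]addrAC subrr add0r.
by rewrite mulrCA ler_piMl.
Qed.

(** The second difference is, by [line_MVT_shift], a difference of two gradients near [x] paired
    with [t *: w]; each gradient is then expanded to first order at [x]. *)
Lemma second_difference f x v w : (forall z, differentiable f z) ->
  differentiable (gradient f) x -> forall e, 0 < e ->
  \forall t \near (0 : R)^'+,
    `|f (x + t *: v + t *: w) - f (x + t *: v) - f (x + t *: w) + f x
      - t ^+ 2 * dot ('d (gradient f) x v) w| <= e * t ^+ 2.
Proof.
move=> df dG e e0.
set G := gradient f.
pose N := `|v| + `|w|.
have N0 : 0 <= N by rewrite addr_ge0.
pose C := 2 * Num.sqrt n%:R * N * enorm w.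
have C0 : 0 <= C by rewrite !mulr_ge0 ?sqrtr_ge0 ?enorm_ge0.
have e1 : 0 < e / (C + 1) by rewrite divr_gt0// ltr_wpDl.
have /nbhs_normP[d /= d0 Hd] := diff_frechet dG e1.
near=> t.
have t0 : 0 < t by near: t; exact: nbhs_right_gt.
have td : t * N < d.
  apply: (@le_lt_trans _ _ (t * (N + 1))); first by rewrite ler_pM2l// lerDl.
  rewrite -ltr_pdivlMr ?ltr_wpDl//; near: t; apply: nbhs_right_lt.
  by rewrite divr_gt0// ltr_wpDl.
have [s /andP[s0 s1] E] := line_MVT_shift x (t *: w) (t *: v) df.
rewrite (addrAC x) [leLHS](_ : _ = `|f (x + t *: w + t *: v) - f (x + t *: v)
    - (f (x + t *: w) - f x) - t ^+ 2 * dot ('d G x v) w|); last by congr `|_|; ring.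
rewrite (addrAC x) E dotZr expr2 -mulrA -mulrBr normrM gtr0_norm//.
rewrite [e * _]mulrCA ler_pM2l//.
rewrite -dotZl -dotBl (le_trans (cauchy_schwarz _ _))//.
set h2 := s *: (t *: w); set h1 := h2 + t *: v.
have hN1 : `|h1| <= t * N.
  rewrite (le_trans (ler_normD _ _))// !normrZ (ger0_norm s0) gtr0_norm// /N mulrDr addrC.
  by rewrite lerD// ler_piMl// mulr_ge0// ltW.
have hN2 : `|h2| <= t * N.
  rewrite !normrZ (ger0_norm s0) (gtr0_norm t0) /N mulrDr.
  apply: (@le_trans _ _ (t * `|w|)); first by rewrite ler_piMl// mulr_ge0// ltW.
  by rewrite lerDr mulr_ge0// ltW.
have B h : `|h| <= t * N -> `|G (x + h) - G x - 'd G x h| <= e / (C + 1) * (t * N).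
  move=> hN; apply: (le_trans (Hd h _)).
    by rewrite /= sub0r normrN (le_lt_trans hN).
  by rewrite ler_pM2l.
(* By linearity the contribution of the intermediate point [h2] to the two expansions cancels, and
   only the remainders are left. *)
have -> : G (x + h2 + t *: v) - G (x + h2) - t *: 'd G x v =
    (G (x + h1) - G x - 'd G x h1) - (G (x + h2) - G x - 'd G x h2).
  have DE : 'd G x h1 = 'd G x h2 + t *: 'd G x v.
    by apply: (etrans (linearD _ _ _)); congr (_ + _); exact: linearZ.
  have cancel (a b c p q : V) : a - b - q = a - c - (p + q) - (b - c - p).
    by apply/rowP => i; rewrite !mxE; ring.
  by rewrite DE addrA; exact: cancel.
have : `|(G (x + h1) - G x - 'd G x h1) - (G (x + h2) - G x - 'd G x h2)|
    <= 2 * (e / (C + 1) * (t * N)).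
  rewrite (le_trans (ler_normB _ _))// mulrDl mul1r lerD ?B//.
set D := (_ - _) => HD.
apply: (@le_trans _ _ (Num.sqrt n%:R * (2 * (e / (C + 1) * (t * N))) * enorm w)).
  rewrite ler_wpM2r ?enorm_ge0// (le_trans (enorm_le_norm _))// ler_wpM2l// sqrtr_ge0//.
have -> : Num.sqrt n%:R * (2 * (e / (C + 1) * (t * N))) * enorm w =
    (e * t) * (C / (C + 1)) by rewrite /C; ring.
have C1 : C / (C + 1) <= 1 by rewrite ler_pdivrMr ?ltr_wpDl// mul1r lerDl.
by apply: ler_piMr C1; rewrite mulr_ge0 ?ltW.
Unshelve. all: by end_near. Qed.

(** The second difference is symmetric in [v] and [w]; dividing by [t ^+ 2] and letting [t] tend to
    [0] gives the symmetry of the bilinear form. *)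
Lemma hessian_sym f x : (forall z, differentiable f z) ->
  differentiable (gradient f) x -> (hessian f x)^T = hessian f x.
Proof.
move=> df dG.
have sym v w : dot ('d (gradient f) x v) w = dot ('d (gradient f) x w) v.
  apply/eqP; rewrite -subr_eq0 -normr_eq0 eq_le normr_ge0 andbT.
  apply/ler_addgt0Pr => e e0; rewrite add0r.
  have e2 : 0 < e / 2 by rewrite divr_gt0.
  near (0 : R)^'+ => t.
  have t0 : 0 < t by near: t; exact: nbhs_right_gt.
  have h1 : `|f (x + t *: v + t *: w) - f (x + t *: v) - f (x + t *: w) + f x
      - t ^+ 2 * dot ('d (gradient f) x v) w| <= e / 2 * t ^+ 2.
    by near: t; exact: second_difference.
  have h2 : `|f (x + t *: w + t *: v) - f (x + t *: w) - f (x + t *: v) + f x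
      - t ^+ 2 * dot ('d (gradient f) x w) v| <= e / 2 * t ^+ 2.
    by near: t; exact: second_difference.
  have tt : 0 < t ^+ 2 by rewrite exprn_gt0.
  rewrite -(ler_pM2r tt) -(gtr0_norm tt) -normrM (gtr0_norm tt).
  rewrite [leRHS](_ : _ = e / 2 * t ^+ 2 + e / 2 * t ^+ 2); last by field.
  move: h1 h2; rewrite (addrAC x (t *: w)).
  set F := f (x + _ + _); set F1 := f (x + t *: v); set F2 := f (x + t *: w).
  set d1 := dot _ w; set d2 := dot _ v => h1 h2.
  apply: le_trans (lerD h2 h1); rewrite [leLHS](_ : _ = `|(F - F2 - F1 + f x - t ^+ 2 * d2)
    - (F - F1 - F2 + f x - t ^+ 2 * d1)|); first exact: ler_normB.
  by congr `|_|; ring.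
apply/matrixP => i j; rewrite !mxE.
have := sym (delta_mx ord0 j) (delta_mx ord0 i).
have dd (u : V) k : dot u (delta_mx ord0 k) = u ord0 k.
  rewrite /dot (bigD1 k)//= !mxE !eqxx mulr1 big1 ?addr0// => l lk.
  by rewrite mxE eqxx (negbTE lk) mulr0.
by rewrite !dd.
Unshelve. all: by end_near. Qed.

End gradient_calculus.

(** * Averages over balls *)

Section ball_average.
Context {R : realType} (n : nat).
Local Notation V := 'rV[R]_n.
Local Notation P := (@unif_ball R n).
Implicit Types (g : V -> R) (x h w : V) (s : R).

Definition ball_average s g x : R := \int[P]_u g (x + s *: u).

Lemma smoothingE s g : smoothing s g = ball_average s g.
Proof. by apply/funext => x; rewrite /smoothing unlock. Qed.

Lemma expectation_mxE p q (X : V -> 'M[R]_(p, q)) i j :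
  expectation_mx P X i j = \int[P]_u X u i j.
Proof. by rewrite mxE unlock. Qed.

Lemma unif_ball_ae (Q : V -> Prop) x s : 0 < s ->
  {ae lam n, forall z, Q z} -> {ae P, forall u, Q (x + s *: u)}.
Proof.
move=> s0 [N [mN N0 QN]]; exists [set u | N (x + s *: u)]; split.
- by rewrite -[X in measurable X]setTI; exact: measurable_affine.
- exact: unif_ball_null.
- by move=> u /= nQ; apply: QN.
Qed.

Lemma measurable_shift g x s : measurable_fun setT g ->
  measurable_fun setT (fun u : V => g (x + s *: u)).
Proof. by move=> mg; apply: (measurableT_comp mg); exact: measurable_affine. Qed.

Lemma integrable_shift_bounded g x s (K : R) : measurable_fun setT g ->
  (forall z, `|g z| <= K) -> P.-integrable setT (EFin \o (fun u => g (x + s *: u))).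
Proof.
move=> mg gK; apply: (@unif_ball_integrable _ _ _ K); first exact: measurable_shift.
by move=> u _.
Qed.

Lemma integrable_shift_lipschitz g x s (M : R) : 0 <= M -> 0 <= s ->
  (forall y z, `|g y - g z| <= M * `|y - z|) ->
  P.-integrable setT (EFin \o (fun u => g (x + s *: u))).
Proof.
move=> M0 s0 gM; apply: (@unif_ball_integrable _ _ _ (`|g x| + M * s)).
  by apply: measurable_shift; exact: measurable_lipschitz gM.
move=> u u1; rewrite -[g _](subrK (g x)) addrC (le_trans (ler_normD _ _))// lerD2l.
rewrite (le_trans (gM _ _))// ler_wpM2l// [x + _]addrC addrK normrZ ger0_norm//.
by rewrite ler_piMr// (le_trans (norm_le_enorm u)).
Qed.

Lemma unif_ball_norm_le g (K : R) : measurable_fun setT g ->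
  (forall z, `|g z| <= K) -> `|\int[P]_u g u| <= K.
Proof.
move=> mg gK; have := @Rintegral_norm_le _ _ _ P setT g K measurableT.
by rewrite [X in fine X]probability_setT mulr1; apply => //; rewrite [ltLHS]probability_setT ltry.
Qed.

Lemma ball_average_norm_le s g x (K : R) : measurable_fun setT g ->
  (forall z, `|g z| <= K) -> `|ball_average s g x| <= K.
Proof.
by move=> mg gK; apply: unif_ball_norm_le => //; exact: measurable_shift.
Qed.

(** Since [x + s u = y + s (u + (x - y) / s)], moving the centre amounts to translating the uniform
    point by [(x - y) / s]. *)
Lemma ball_average_lipschitz s g (K : R) x y : (0 < n)%N -> 0 < s ->
  measurable_fun setT g -> (forall z, `|g z| <= K) ->
  `|ball_average s g x - ball_average s g y| <=
    16 * K * Num.sqrt n%:R / s * enorm (x - y).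
Proof.
move=> n0 s0 mg gK.
have := @Rintegral_translate_le R n n0 (s^-1 *: (x - y)) (fun u => g (y + s *: u))
  K (measurable_shift _ _ mg) (fun u => gK _).
have xE u : y + s *: (u + s^-1 *: (x - y)) = x + s *: u.
  by rewrite scalerDr scalerA mulfV ?gt_eqF// scale1r addrCA [y + _]addrC subrK addrC.
under eq_Rintegral do rewrite xE.
by rewrite enormZ [`|s^-1|]gtr0_norm ?invr_gt0// mulrA.
Qed.

(* Where [g] is differentiable, the difference quotients of the error term of
   [ball_average s g] along a hypothetical bad sequence of increments are bounded
   and tend to 0 almost everywhere. *)
Lemma ball_average_frechet s g (d : 'I_n -> V -> R) (M C : R) x :
  0 < s -> 0 <= M -> (forall y z, `|g y - g z| <= M * `|y - z|) ->
  (forall i, measurable_fun setT (d i)) -> (forall i z, `|d i z| <= C) ->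
  {ae lam n, forall z, forall e, 0 < e ->
    \forall h \near (0 : V), `|g (z + h) - g z - \sum_i h ord0 i * d i z| <= e * `|h|} ->
  forall e, 0 < e -> \forall h \near (0 : V),
    `|ball_average s g (x + h) - ball_average s g x
      - \sum_i h ord0 i * ball_average s (d i) x| <= e * `|h|.
Proof.
move=> s0 M0 gM md dC fr e e0.
have mg := measurable_lipschitz gM.
have dh h z : `|\sum_i h ord0 i * d i z| <= (\sum_(i < n) C) * `|h|.
  rewrite (le_trans (ler_norm_sum _ _ _))// mulr_suml ler_sum// => i _.
  by rewrite normrM mulrC ler_pM ?mx_entry_le.
have mdh h : measurable_fun setT (fun z => \sum_i h ord0 i * d i z).
  by apply: measurable_sum => i; exact: measurable_funM.
pose r h z := g (z + h) - g z - \sum_i h ord0 i * d i z.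
have mr h : measurable_fun setT (r h).
  apply: measurable_funB; first apply: measurable_funB => //.
    exact: (measurableT_comp mg (measurable_translate h)).
  exact: mdh.
pose K := M + \sum_(i < n) C.
have rK h z : `|r h z| <= K * `|h|.
  rewrite mulrDl (le_trans (ler_normB _ _))// lerD//.
  by rewrite (le_trans (gM _ _))// [z + h]addrC addrK.
have avg_r h : ball_average s (r h) x = ball_average s g (x + h) - ball_average s g x
    - \sum_i h ord0 i * ball_average s (d i) x.
  rewrite /ball_average /r.
  have ig y := @integrable_shift_lipschitz g y s M M0 (ltW s0) gM.
  have igh : P.-integrable setT (EFin \o (fun u => g (x + s *: u + h))).
    by have := ig (x + h); under eq_fun do rewrite addrAC.
  have di i := @integrable_shift_bounded (d i) x s C (md i) (dC i).
  have iZ i : P.-integrable setT (EFin \o (fun u => h ord0 i * d i (x + s *: u))).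
    have := integrableZl measurableT (h ord0 i) (di i).
    by congr (_.-integrable _ _); apply/funext => u.
  rewrite RintegralB//; last first.
    exact: integrable_shift_bounded (mdh h) (dh h).
    by have := integrableB measurableT igh (ig x); congr (_.-integrable _ _); apply/funext => u.
  rewrite RintegralB// Rintegral_sum//; congr (_ - _ - _).
    by apply: eq_Rintegral => u _; rewrite addrAC.
  by apply: eq_bigr => i _; rewrite RintegralZl.
apply: contrapT => H.
(* Failure of the bound in every neighbourhood of [0] supplies a violating increment of length below
   [1 / (k + 1)]. *)
have bad k : {h : V | `|h| < k.+1%:R^-1 & e * `|h| < `|ball_average s (r h) x|}.
  apply: cid2; apply: contrapT => nb; apply: H.
  apply/nbhs_normP; exists k.+1%:R^-1; first by rewrite /= invr_gt0.
  move=> h /=; rewrite sub0r normrN => hk; rewrite -avg_r leNgt; apply/negP => hb.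
  by apply: nb; exists h.
pose h_ k := s2val (bad k).
have h_lt k : `|h_ k| < k.+1%:R^-1 by exact: (s2valP (bad k)).
have h_bad k : e * `|h_ k| < `|ball_average s (r (h_ k)) x| by exact: (s2valP' (bad k)).
have h_gt0 k : 0 < `|h_ k|.
  rewrite normr_gt0; apply/negP => /eqP h0; have := h_bad k.
  rewrite h0 normr0 mulr0 ltNge (le_trans (ball_average_norm_le _ _ (mr 0) (rK 0)))//.
  by rewrite normr0 mulr0.
have h_cvg : h_ k @[k --> \oo] --> (0 : V).
  apply/cvgrPdist_lt => d' d'0; near=> k; rewrite sub0r normrN (lt_trans (h_lt k))//.
  near: k; have := @cvg_harmonic R => /cvgrPdist_lt/(_ _ d'0); apply: filterS => k.
  by rewrite sub0r normrN /harmonic/= gtr0_norm ?invr_gt0.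
pose q k z := `|h_ k|^-1 * r (h_ k) z.
have mq k : measurable_fun setT (fun u : V => q k (x + s *: u)).
  by apply: measurable_funM => //; exact: measurable_shift.
have qK k z : `|q k z| <= K.
  by rewrite normrM gtr0_norm ?invr_gt0// mulrC ler_pdivrMr.
have q0 : {ae P, forall u, q k (x + s *: u) @[k --> \oo] --> (0 : R)}.
  apply: (unif_ball_ae x s0 (Q := fun z => q k z @[k --> \oo] --> (0 : R))).
  apply: filterS fr => z frz; apply/cvgrPdist_le => e' e'0.
  have rk : \forall k \near \oo, `|r (h_ k) z| <= e' * `|h_ k|.
    exact: h_cvg _ (frz e' e'0).
  apply: filterS rk => k rk.
  by rewrite sub0r normrN normrM gtr0_norm ?invr_gt0// mulrC ler_pdivrMr//.
have := @bounded_cvg_integral _ _ _ P setT _ _ _ measurableT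
  (le_lt_trans (probability_le1 P measurableT) (ltry 1)) mq
  (@measurable_cst _ _ _ _ setT (0 : R)) (fun k u => qK k _) q0.
(* At some index [N] the averaged normalised error falls below [e], which contradicts [h_bad N]. *)
rewrite integral0 => /fine_cvg /cvgrPdist_lt /(_ _ e0)[N _ /(_ N (leqnn N))] /=.
rewrite sub0r normrN -/(Rintegral P setT (fun u => q N (x + s *: u))).
rewrite RintegralZl//; last first.
  by apply: integrable_shift_bounded (mr _) (rK _).
rewrite -/(ball_average s (r (h_ N)) x) normrM gtr0_norm ?invr_gt0// mulrC.
by rewrite ltr_pdivrMr// ltNge ltW.
Unshelve. all: by end_near. Qed.

End ball_average.

(** * Scalar products as linear maps, and bounds on the spectral norm by duality *)

Section dot_linear.
Context {R : realType} (n : nat) (a : 'rV[R]_n).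

Let dot_is_linear : linear_for *%R (dot a).
Proof. by move=> k x y; rewrite dotDr dotZr. Qed.

HB.instance Definition _ := GRing.isLinear.Build R 'rV[R]_n R *%R (dot a) dot_is_linear.

Lemma dot_continuous : continuous (dot a).
Proof.
apply: (@lipschitz_continuous _ _ _ _ (enorm a * Num.sqrt n%:R)) => x y.
rewrite -dotBr (le_trans (cauchy_schwarz _ _))// -mulrA ler_wpM2l ?enorm_ge0//.
exact: enorm_le_norm.
Qed.

End dot_linear.

Lemma spectral_norm_le {R : realType} n (A : 'M[R]_n) (c : R) : 0 <= c ->
  (forall v w : 'rV[R]_n, enorm v <= 1 -> dot w (v *m A^T) <= enorm w * c) ->
  spectral_norm A <= c.
Proof.
move=> c0 Ac; apply: ge_sup.
  (* The supremum bound requires a nonempty set, and [v = 0] provides an element. *)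
  by exists (enorm ((0 : 'rV[R]_n) *m A^T)), 0 => //=; rewrite enorm0.
by move=> _ [v /= v1 <-]; apply: enorm_dual => // w; exact: Ac.
Qed.

Lemma mx_entryB_le {R : realType} n (a b : 'rV[R]_n) i :
  `|a ord0 i - b ord0 i| <= `|a - b|.
Proof. by have := mx_entry_le (a - b) i; rewrite !mxE. Qed.

(** A bound on increments over steps [t *: v] at two points passes to the differentials after
    division by [t]. *)
Lemma dot_jacobianB_le {R : realType} n (F : 'rV[R]_n -> 'rV[R]_n) x y v w
    (A B : 'M[R]_n) (c : R) :
  differentiable F x -> 'd F x = (fun h => h *m A) :> ('rV[R]_n -> 'rV[R]_n) ->
  differentiable F y -> 'd F y = (fun h => h *m B) :> ('rV[R]_n -> 'rV[R]_n) ->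
  (forall t, 0 < t ->
    dot w (F (x + t *: v) - F x) - dot w (F (y + t *: v) - F y) <= t * c) ->
  dot w (v *m (A - B)) <= c.
Proof.
move=> dx dxE dy dyE Fc; apply/ler_addgt0Pr => e e0.
(* Chosen so that the first-order remainders at [x] and [y], paired with [w], add up to at most
   [t * e]; the factor 2 counts the two points. *)
pose K := enorm w * Num.sqrt n%:R * `|v| * 2.
have K0 : 0 <= K by rewrite !mulr_ge0 ?enorm_ge0 ?sqrtr_ge0.
have e1 : 0 < e / (K + 1) by rewrite divr_gt0// ltr_wpDl.
have fr z (D : 'M[R]_n) : differentiable F z ->
    'd F z = (fun h => h *m D) :> ('rV[R]_n -> 'rV[R]_n) ->
    \forall t \near (0 : R)^'+, `|dot w (F (z + t *: v) - F z - t *: (v *m D))|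
      <= e / (K + 1) * (K / 2) * t.
  move=> dz dzE; have /nbhs_normP[d /= d0 Hd] := diff_frechet dz e1.
  near=> t.
  have t0 : 0 < t by near: t; exact: nbhs_right_gt.
  have tv : `|t *: v| < d.
    rewrite normrZ gtr0_norm// (@le_lt_trans _ _ (t * (`|v| + 1)))//.
      by rewrite ler_pM2l// lerDl.
    rewrite -ltr_pdivlMr ?ltr_wpDl//; near: t; apply: nbhs_right_lt.
    by rewrite divr_gt0// ltr_wpDl.
  have := Hd (t *: v); rewrite dzE -scalemxAl /= sub0r normrN => /(_ tv) H.
  rewrite (le_trans (cauchy_schwarz _ _))//.
  rewrite (le_trans (ler_wpM2l (enorm_ge0 _) (enorm_le_norm _)))//.
  rewrite mulrA (le_trans (ler_wpM2l _ H)) ?mulr_ge0 ?enorm_ge0 ?sqrtr_ge0//.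
  rewrite normrZ gtr0_norm// le_eqVlt /K; apply/orP; left; apply/eqP.
  by field; rewrite gt_eqF// ltr_wpDl.
near (0 : R)^'+ => t.
have t0 : 0 < t by near: t; exact: nbhs_right_gt.
have Bx : `|dot w (F (x + t *: v) - F x - t *: (v *m A))| <= e / (K + 1) * (K / 2) * t.
  by near: t; exact: fr.
have By : `|dot w (F (y + t *: v) - F y - t *: (v *m B))| <= e / (K + 1) * (K / 2) * t.
  by near: t; exact: fr.
have T := Fc t t0.
rewrite -(ler_pM2l t0) -dotZr mulmxBr scalerBr dotBr.
move: Bx By; rewrite [X in `|X|]dotBr => Bx; rewrite [X in `|X|]dotBr.
move: Bx; rewrite !ler_norml => /andP[Bx _] /andP[_ By].
have KE : e / (K + 1) * (K / 2) * t * 2 <= t * e.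
  have -> : e / (K + 1) * (K / 2) * t * 2 = t * e * (K / (K + 1)).
    by field; rewrite gt_eqF// ltr_wpDl.
  have K1 : K / (K + 1) <= 1 by rewrite ler_pdivrMr ?ltr_wpDl// mul1r lerDl.
  by apply: ler_piMr K1; rewrite mulr_ge0 ?ltW.
rewrite mulrDr; lra.
Unshelve. all: by end_near. Qed.

(** * The averaged gradient and Hessian of a smooth function *)

Section smooth_average.
Context {R : realType} (n : nat).
Local Notation V := 'rV[R]_n.
Local Notation P := (@unif_ball R n).
Context (L s : R) (f : V -> R) (L0 : 0 < L) (s0 : 0 < s) (fL : smooth L f).
Implicit Types x y h v w z : V.

Local Notation G := (gradient f).
Local Notation avg := (ball_average s).
(** A Lipschitz constant of the gradient for the maximum norm, in which differentiability and
    Rademacher's theorem are stated. *)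
Let M : R := L * Num.sqrt n%:R.
Let Gc i z : R := G z ord0 i.

Definition average_gradient x : V := \row_i avg (fun z => G z ord0 i) x.

(** Averages [jacobian_dq], whose entries are measurable by construction; [average_hessianE]
    identifies it with the average of the Hessian. *)
Definition average_hessian x : 'M[R]_n :=
  \matrix_(i, j) avg (fun z => jacobian_dq G z i j) x.

Let M0 : 0 <= M.
Proof. by rewrite mulr_ge0 ?sqrtr_ge0// ltW. Qed.

Lemma smooth_gradient_lipschitz x y : `|G x - G y| <= M * `|x - y|.
Proof.
rewrite (le_trans (norm_le_enorm _))// (le_trans (fL.2 x y))// -mulrA ler_pM2l//.
exact: enorm_le_norm.
Qed.

Lemma smooth_gradient_coord_lipschitz i x y : `|Gc i x - Gc i y| <= M * `|x - y|.
Proof.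
rewrite (le_trans _ (smooth_gradient_lipschitz x y))//.
exact: mx_entryB_le.
Qed.

Let integrable_Gc i x : P.-integrable setT (EFin \o (fun u => G (x + s *: u) ord0 i)).
Proof.
exact: (integrable_shift_lipschitz (g := Gc i) x M0 (ltW s0) (smooth_gradient_coord_lipschitz i)).
Qed.

Lemma measurable_dot_gradient w : measurable_fun setT (fun z => dot w (G z)).
Proof.
apply: measurable_sum => i; apply: measurable_funM => //.
exact: measurable_lipschitz (smooth_gradient_coord_lipschitz i).
Qed.

Lemma smooth_measurable : measurable_fun setT f.
Proof.
apply: continuous_measurable_rV => x; apply: differentiable_continuous.
exact: fL.1.
Qed.

Lemma integrable_shift_smooth x : P.-integrable setT (EFin \o (fun u => f (x + s *: u))).
Proof.
apply: (@unif_ball_integrable _ _ _ (L * s ^+ 2 + enorm (G x) * s + `|f x|)).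
  by apply: measurable_shift; exact: smooth_measurable.
move=> u u1.
have -> : f (x + s *: u) = f (x + s *: u) - f x - dot (G x) (s *: u)
    + dot (G x) (s *: u) + f x by ring.
rewrite (le_trans (ler_normD _ _))// lerD2r (le_trans (ler_normD _ _))// lerD//.
  rewrite (le_trans (smooth_taylor _ _ fL))// enormZ gtr0_norm// ler_pM2l// exprMn.
  have u2 : enorm u ^+ 2 <= 1 by rewrite expr_le1// enorm_ge0.
  by apply: ler_piMr u2; rewrite exprn_ge0// ltW.
rewrite (le_trans (cauchy_schwarz _ _))// enormZ gtr0_norm// ler_wpM2l ?enorm_ge0//.
by apply: ler_piMr u1; rewrite ltW.
Qed.

Lemma dot_average_gradient w x :
  dot w (average_gradient x) = avg (fun z => dot w (G z)) x.
Proof.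
rewrite /ball_average /dot Rintegral_sum => [|i]; last first.
  have := integrableZl measurableT (w ord0 i) (integrable_Gc i x).
  by congr (_.-integrable _ _); apply/funext => u.
by apply: eq_bigr => i _; rewrite RintegralZl// mxE.
Qed.

Lemma integrable_dot_gradient w x :
  P.-integrable setT (EFin \o (fun u => dot w (G (x + s *: u)))).
Proof.
apply: (@integrable_shift_lipschitz _ _ (fun z => dot w (G z)) x s (enorm w * M)) => //.
- by rewrite mulr_ge0 ?enorm_ge0.
- exact: ltW.
move=> y z; rewrite -dotBr (le_trans (cauchy_schwarz _ _))// -mulrA.
rewrite ler_wpM2l ?enorm_ge0// (le_trans (fL.2 _ _))// /M -mulrA ler_pM2l//.
exact: enorm_le_norm.
Qed.

Lemma dot_average_gradientB w x y :
  dot w (average_gradient x - average_gradient y) =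
  \int[P]_u (dot w (G (x + s *: u)) - dot w (G (y + s *: u))).
Proof.
apply: (etrans (dotBr _ _ _)).
apply: (etrans (congr2 (fun a b => a - b) (dot_average_gradient w x) (dot_average_gradient w y))).
exact: esym (RintegralB measurableT (integrable_dot_gradient w x) (integrable_dot_gradient w y)).
Qed.

(** The Taylor bound holds at every base point [x + s *: u] with the same right-hand side, so it
    survives averaging. *)
Lemma average_taylor x h :
  `|avg f (x + h) - avg f x - dot (average_gradient x) h| <= L * enorm h ^+ 2.
Proof.
rewrite dotC dot_average_gradient.
have -> : avg f (x + h) - avg f x - avg (fun z => dot h (G z)) x =
    avg (fun z => f (z + h) - f z - dot (G z) h) x.
  rewrite /ball_average.
  have I1 : P.-integrable setT (EFin \o (fun u => f (x + s *: u + h))).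
    by have := integrable_shift_smooth (x + h); under eq_fun do rewrite addrAC.
  have I2 := integrable_shift_smooth x.
  have I3 : P.-integrable setT (EFin \o (fun u => dot (G (x + s *: u)) h)).
    by have := integrable_dot_gradient h x; under eq_fun do rewrite dotC.
  rewrite RintegralB//; last first.
    by have := integrableB measurableT I1 I2; congr (_.-integrable _ _); apply/funext => u.
  rewrite RintegralB//; congr (_ - _ - _); apply: eq_Rintegral => u _.
    by rewrite addrAC.
  exact: dotC.
apply: ball_average_norm_le; last by move=> z; exact: smooth_taylor.
apply: measurable_funB; first apply: measurable_funB.
- exact: (measurableT_comp smooth_measurable (measurable_translate h)).
- exact: smooth_measurable.
- have := measurable_dot_gradient h; congr (measurable_fun _ _).
  by apply/funext => z; exact: dotC.
Qed.

Lemma average_diff x : differentiable (avg f) x /\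
  'd (avg f) x = dot (average_gradient x) :> (V -> R).
Proof.
apply: frechet_diff; first exact: dot_continuous.
move=> e e0; pose C := L * n%:R.
have C0 : 0 <= C by rewrite mulr_ge0// ltW.
apply/nbhs_normP; exists (e / (C + 1)); first by rewrite /= divr_gt0// ltr_wpDl.
move=> h /=; rewrite sub0r normrN => he.
rewrite (le_trans (average_taylor x h))//.
have hh : enorm h ^+ 2 <= n%:R * `|h| ^+ 2.
  rewrite -[n%:R]sqr_sqrtr// -exprMn lerXn2r ?nnegrE ?enorm_ge0 ?mulr_ge0 ?sqrtr_ge0//.
  exact: enorm_le_norm.
apply: (@le_trans _ _ (C * `|h| * `|h|)).
  by rewrite -mulrA -expr2 /C -mulrA ler_pM2l.
rewrite ler_wpM2r// (@le_trans _ _ ((C + 1) * `|h|))//.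
  by rewrite ler_wpM2r// lerDl.
by rewrite mulrC -ler_pdivlMr ?ltr_wpDl// ltW.
Qed.

Lemma average_gradientE x : gradient (avg f) x = average_gradient x.
Proof.
apply/rowP => i; rewrite /gradient mxE (average_diff x).2.
rewrite /dot (bigD1 i)//= [X in _ * X]mxE !eqxx mulr1 big1 ?addr0// => j ji.
by rewrite [X in _ * X]mxE eqxx (negbTE ji) mulr0.
Qed.

Lemma average_gradient_lipschitz x y :
  enorm (average_gradient x - average_gradient y) <= L * enorm (x - y).
Proof.
have Lxy : 0 <= L * enorm (x - y) by rewrite mulr_ge0 ?enorm_ge0// ltW.
apply: enorm_dual => // w.
rewrite dot_average_gradientB.
apply: le_trans (ler_norm _) _.
apply: unif_ball_norm_le.
  by apply: measurable_funB; exact: measurable_shift (measurable_dot_gradient w).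
move=> z; rewrite -dotBr (le_trans (cauchy_schwarz _ _))// ler_wpM2l ?enorm_ge0//.
by rewrite (le_trans (fL.2 _ _))// opprD addrACA subrr addr0.
Qed.

(** Rademacher's theorem gives the expansion of the gradient at almost every point, and
    [ball_average_frechet] turns it, one component at a time, into an expansion of the average at
    every point. *)
Lemma average_gradient_diff x : differentiable average_gradient x /\
  'd average_gradient x = (fun h => h *m average_hessian x) :> (V -> V).
Proof.
(* Rademacher's theorem is stated for a positive constant, whereas [M] is [0] when [n = 0]. *)
have M1 : 0 < M + 1 by rewrite ltr_wpDl.
have GM1 y z : `|G y - G z| <= (M + 1) * `|y - z|.
  by rewrite (le_trans (smooth_gradient_lipschitz y z))// ler_wpM2r// lerDl.
have GcM1 i y z : `|Gc i y - Gc i z| <= (M + 1) * `|y - z|.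
  by rewrite (le_trans (smooth_gradient_coord_lipschitz i y z))// ler_wpM2r// lerDl.
have R_ := rademacher M1 GM1.
have fr j e : 0 < e -> \forall h \near (0 : V), `|avg (Gc j) (x + h) - avg (Gc j) x
    - \sum_i h ord0 i * avg (fun z => jacobian_dq G z i j) x| <= e * `|h|.
  apply: (@ball_average_frechet _ _ s (Gc j) (fun i z => jacobian_dq G z i j) M
    (\sum_i (M + 1) * `|delta_mx ord0 i : V|)) => //.
  - exact: smooth_gradient_coord_lipschitz.
  - move=> i; have := measurable_dirderiv (smooth_gradient_coord_lipschitz j) (delta_mx ord0 i).
    by congr (measurable_fun _ _); apply/funext => z; rewrite mxE.
  - move=> i z; rewrite mxE (le_trans (dirderiv_le M1 (GcM1 j) _ _))//.
    by rewrite (bigD1 i)//= lerDl sumr_ge0// => k _; rewrite mulr_ge0// ltW.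
  apply: filterS R_ => z [dz Jz] e' e'0; apply: filterS (diff_frechet dz e'0) => h.
  apply: le_trans; have := mx_entry_le (G (z + h) - G z - 'd G z h) j.
  rewrite (_ : 'd G z h = h *m jacobian_dq G z); last first.
    by rewrite -Jz mul_rV_lin1.
  have E (a b c : V) : (a - b - c) ord0 j = a ord0 j - b ord0 j - c ord0 j.
    by rewrite !mxE.
  by rewrite E [X in _ - X]mxE => H; exact: H.
have [] // := @frechet_diff R _ _ average_gradient x (mulmxr (average_hessian x)).
- exact: mulmxr_continuous.
- move=> e e0; have := @filter_forall _ 'I_n (fun j h => `|avg (Gc j) (x + h)
    - avg (Gc j) x - \sum_i h ord0 i * avg (fun z => jacobian_dq G z i j) x| <= e * `|h|)
    _ (nbhs_filter (0 : V)) (fun j => fr j e e0).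
  apply: filterS => h hj; apply: rV_norm_le => [|j]; first by rewrite mulr_ge0// ltW.
  rewrite !mxE; under eq_bigr do rewrite mxE.
  exact: hj.
Qed.

(** The two integrands agree off a null set; [integral_null_eq] concludes without measurability of
    the Hessian. *)
Lemma average_hessianE x :
  average_hessian x = expectation_mx P (fun u => hessian f (x + s *: u)).
Proof.
have M1 : 0 < M + 1 by rewrite ltr_wpDl.
have GM1 y z : `|G y - G z| <= (M + 1) * `|y - z|.
  by rewrite (le_trans (smooth_gradient_lipschitz y z))// ler_wpM2r// lerDl.
have [N [mN N0 NG]] := unif_ball_ae x s0 (rademacher M1 GM1).
apply/matrixP => i j; rewrite expectation_mxE mxE /ball_average /Rintegral.
congr fine; apply: (integral_null_eq mN N0) => u Nu.
have [_ JE] : differentiable G (x + s *: u) /\ 'J G (x + s *: u) = jacobian_dq G (x + s *: u).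
  by apply: contrapT => nQ; apply: Nu; exact: NG.
by rewrite /hessian JE.
Qed.

(** The increment [h] of [<w, G>] over [t *: v] is bounded by [|w| L t], so its averages at [x] and
    [y] differ by at most [t] times the claimed bound; [dot_jacobianB_le] removes [t]. *)
Lemma average_hessian_lipschitz x y v w : (0 < n)%N -> enorm v <= 1 ->
  dot w (v *m (average_hessian x - average_hessian y)) <=
  enorm w * (16 * L * Num.sqrt n%:R / s * enorm (x - y)).
Proof.
move=> n0 v1; have [dx dxE] := average_gradient_diff x.
have [dy dyE] := average_gradient_diff y.
apply: (dot_jacobianB_le dx dxE dy dyE) => t t0.
pose h z := dot w (G (z + t *: v) - G z).
have hE z : dot w (average_gradient (z + t *: v) - average_gradient z) = avg h z.
  rewrite dot_average_gradientB; apply: eq_Rintegral => u _.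
  by rewrite /h dotBr addrAC.
have mh : measurable_fun setT h.
  have -> : h = (fun z => dot w (G (z + t *: v)) - dot w (G z)).
    by apply/funext => z; rewrite /h dotBr.
  apply: measurable_funB; last exact: measurable_dot_gradient.
  by apply: (measurableT_comp (measurable_dot_gradient w)); exact: measurable_translate.
have hL z : `|h z| <= enorm w * L * t.
  rewrite (le_trans (cauchy_schwarz _ _))// -mulrA ler_wpM2l ?enorm_ge0//.
  rewrite (le_trans (fL.2 _ _))// [z + _]addrC addrK enormZ gtr0_norm//.
  by rewrite ler_pM2l//; apply: ler_piMr v1; rewrite ltW.
apply: (@le_trans _ _ (avg h x - avg h y)).
  by rewrite le_eqVlt; apply/orP; left; apply/eqP; exact: (congr2 (fun a b => a - b) (hE x) (hE y)).
apply: le_trans (le_trans (ler_norm _) (ball_average_lipschitz x y n0 s0 mh hL)) _.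
by rewrite le_eqVlt; apply/orP; left; apply/eqP; ring.
Qed.

End smooth_average.

Theorem theorem3p1 (R : realType) :
  exists c : R, 0 < c /\
  forall n : nat, (1 <= n)%N ->
  forall (L sigma : R) (f : 'rV[R]_n -> R),
  0 < L -> 0 < sigma -> smooth L f ->
  let fs := smoothing sigma f in
  [/\ twice_differentiable fs,
      (forall x y : 'rV[R]_n,
         gradient fs x
           = expectation_mx (unif_ball n)
               (fun u => gradient f (x + sigma *: u))
         /\ enorm (gradient fs x - gradient fs y) <= L * enorm (x - y))
    & (forall x y : 'rV[R]_n,
         [/\ (hessian fs x)^T = hessian fs x,
             hessian fs x
               = expectation_mx (unif_ball n)
                   (fun u => hessian f (x + sigma *: u))
           & spectral_norm (hessian fs x - hessian fs y)
               <= c * L * Num.sqrt n%:R / sigma * enorm (x - y)])].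
Proof.
exists 16; split=> // n n0 L s f L0 s0 fL fs.
have fsE : fs = ball_average s f by exact: smoothingE.
have gE : gradient fs = average_gradient s f.
  by apply/funext => x; rewrite fsE; exact: average_gradientE fL x.
have dfs x : differentiable fs x by rewrite fsE; have [] := average_diff L0 s0 fL x.
have dg x : differentiable (gradient fs) x.
  by rewrite gE; have [] := average_gradient_diff L0 s0 fL x.
have hE x : hessian fs x = average_hessian s f x.
  rewrite /hessian gE; apply: jacobianE.
  by have [] := average_gradient_diff L0 s0 fL x.
have sym x : (hessian fs x)^T = hessian fs x by exact: hessian_sym.
split; first by split.
- move=> x y; rewrite gE; split; last exact: average_gradient_lipschitz.
  by apply/rowP => i; rewrite expectation_mxE mxE.
- move=> x y; split; first exact: sym.
  + by rewrite hE; exact: average_hessianE L0 s0 fL x.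
  + apply: spectral_norm_le => [|v w v1].
      by rewrite !mulr_ge0 ?invr_ge0 ?enorm_ge0 ?sqrtr_ge0 ?ltW.
    (* The spectral norm is defined through the transpose, which symmetry of the Hessian removes. *)
    have -> : (hessian fs x - hessian fs y)^T = average_hessian s f x - average_hessian s f y.
      apply: (etrans (linearB _ _ _)).
      exact: (congr2 (fun A B => A - B) (etrans (sym x) (hE x)) (etrans (sym y) (hE y))).
    exact: average_hessian_lipschitz.
Qed.
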